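(* Consider a finite MDP with tabular softmax policies, an initial state distribution $\mu$ with $\min_s\mu(s)>0$, another state distribution $\rho$, and suppose every state $s$ has a unique optimal action $a^*(s)$; let $\pi^*$ be the deterministic optimal policy choosing $a^*(s)$ and $V^*=V^{\pi^*}$. Let $C_\infty:=\max_\pi\|d_\mu^\pi/\mu\|_\infty$, $C'_\infty:=\max_\pi\|d_\rho^\pi/\mu\|_\infty$, and let $\{\theta_t\}$ be generated by $\theta_{t+1}=\theta_t+\eta\,\frac{\partial V^{\pi_{\theta_t}}(\mu)}{\partial\theta_t}\Big/\Big\|\frac{\partial V^{\pi_{\theta_t}}(\mu)}{\partial\theta_t}\Big\|_2$ with $\eta=\frac{1-\gamma}{6(1-\gamma)+8(C_\infty-(1-\gamma))}\cdot\frac{1}{\sqrt S}$. Let $c:=\inf_{s,t\ge1}\pi_{\theta_t}(a^*(s)|s)$ (which is positive). Then for all $t\ge1$, $$V^*(\rho)-V^{\pi_{\theta_t}}(\rho)\le\frac{\big(V^*(\mu)-V^{\pi_{\theta_1}}(\mu)\big)C'_\infty}{1-\gamma}\,e^{-C(t-1)},\qquad C=\frac{(1-\gamma)^2c}{12(1-\gamma)+16(C_\infty-(1-\gamma))}\cdot\frac1S\cdot\Big\|\frac{d_\mu^{\pi^*}}{\mu}\Big\|_\infty^{-1}.$$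
   Context: A finite MDP $(\mathcal{S},\mathcal{A},\mathcal{P},r,\gamma)$ with $S=|\mathcal{S}|$, rewards in $[0,1]$, $\gamma\in[0,1)$. $V^\pi(s)$ is the expected discounted return from $s$ under $\pi$, $V^\pi(\nu)=\sum_s\nu(s)V^\pi(s)$, $Q^\pi(s,a)=r(s,a)+\gamma\sum_{s'}\mathcal{P}(s'|s,a)V^\pi(s')$, $Q^*=Q^{\pi^*}$; $d_\nu^\pi(s)=(1-\gamma)\sum_{t\ge0}\gamma^t\Pr(s_t=s\mid s_0\sim\nu,\pi,\mathcal{P})$. Tabular softmax policy: $\pi_\theta(a|s)=e^{\theta(s,a)}/\sum_{a'}e^{\theta(s,a')}$. *)

(* Defs.v *)
From HB Require Import structures.
From mathcomp Require Import all_boot all_order all_algebra.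
From mathcomp Require Import all_classical all_reals all_analysis.
Set Implicit Arguments. Unset Strict Implicit. Unset Printing Implicit Defensive.
Import Order.TTheory GRing.Theory Num.Theory numFieldNormedType.Exports.
Local Open Scope ring_scope.

Section MDP.
Variables (R : realType) (St Ac : finType).
Variables (P : St -> Ac -> St -> R) (r : St -> Ac -> R) (gamma : R).

Definition is_distr (nu : St -> R) := (forall s, 0 <= nu s) /\ \sum_s nu s = 1.

Definition is_mdp :=
  (forall s a s', 0 <= P s a s') /\ (forall s a, \sum_s' P s a s' = 1) /\
  (forall s a, 0 <= r s a <= 1) /\ 0 <= gamma < 1.

Definition is_policy (pi : St -> Ac -> R) :=
  (forall s a, 0 <= pi s a) /\ (forall s, \sum_a pi s a = 1).

Definition Ppi (pi : St -> Ac -> R) (s s' : St) : R := \sum_a pi s a * P s a s'.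

Fixpoint stdist (pi : St -> Ac -> R) (nu : St -> R) (t : nat) : St -> R :=
  match t with
  | O => nu
  | t'.+1 => fun s' => \sum_s stdist pi nu t' s * Ppi pi s s'
  end.

Definition dirac_st (s : St) : St -> R := fun s' => if s' == s then 1 else 0.

Definition exp_reward (pi : St -> Ac -> R) (nu : St -> R) (t : nat) : R :=
  \sum_s' stdist pi nu t s' * \sum_a pi s' a * r s' a.

(* V^pi(s) = E[ sum_t gamma^t r(s_t,a_t) | s_0 = s ] *)
Definition Vfun (pi : St -> Ac -> R) (s : St) : R :=
  limn (series (fun t => gamma ^+ t * exp_reward pi (dirac_st s) t)).

Definition Vnu (pi : St -> Ac -> R) (nu : St -> R) : R :=
  \sum_s nu s * Vfun pi s.

Definition Qfun (pi : St -> Ac -> R) (s : St) (a : Ac) : R :=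
  r s a + gamma * \sum_s' P s a s' * Vfun pi s'.

Definition dvis (pi : St -> Ac -> R) (nu : St -> R) (s : St) : R :=
  (1 - gamma) * limn (series (fun t => gamma ^+ t * stdist pi nu t s)).

Definition ratio_inf (f mu : St -> R) : R := \big[Num.max/0]_s (f s / mu s).

Definition Cinf (nu mu : St -> R) : R :=
  sup [set x | exists pi, is_policy pi /\ x = ratio_inf (dvis pi nu) mu].

Definition softmax (theta : St -> Ac -> R) (s : St) (a : Ac) : R :=
  expR (theta s a) / \sum_a' expR (theta s a').

Definition det_policy (f : St -> Ac) (s : St) (a : Ac) : R :=
  if a == f s then 1 else 0.

Definition perturb (theta : St -> Ac -> R) (s : St) (a : Ac) (h : R) :=
  fun s' a' => theta s' a' + (if (s' == s) && (a' == a) then h else 0).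

Definition grad (mu : St -> R) (theta : St -> Ac -> R) (s : St) (a : Ac) : R :=
  derive1 (fun h => Vnu (softmax (perturb theta s a h)) mu) 0.

Definition norm2 (g : St -> Ac -> R) : R :=
  Num.sqrt (\sum_s \sum_a g s a ^+ 2).

Definition npg_step (mu : St -> R) (eta : R) (theta : St -> Ac -> R) :=
  fun s a => theta s a + eta * (grad mu theta s a / norm2 (grad mu theta)).

End MDP.

(* Main.v *)
Require Import Defs.
From HB Require Import structures.
From mathcomp Require Import all_boot all_order all_algebra.
From mathcomp Require Import all_classical all_reals all_analysis.
From mathcomp Require Import ring lra.
Set Implicit Arguments. Unset Strict Implicit. Unset Printing Implicit Defensive.
Import Order.TTheory GRing.Theory Num.Theory numFieldNormedType.Exports.
Local Open Scope ring_scope.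

(* The performance difference identity writes the change of value under one update as
   [\sum_s d'(s) \sum_a pi'(a|s) A(s,a) / (1 - gamma)], with [d'] the new visitation
   distribution and [A] the old advantage.  The softmax update tilts [pi(.|s)] by
   [exp (x s .)], where [x s a] is a nonnegative multiple of [pi(a|s) A(s,a)], so every
   term is nonnegative, and [(e^x - 1) / Z] is within a factor close to [1] of [x].  The
   same identity bounds [d / d'] through the concentrability constant, and with the given
   [eta] the step gains at least [eta / 2 * |grad|]; with the gradient domination
   inequality this is linear convergence, at a rate proportional to [c].

   For [c > 0] one needs global convergence.  The values increase at every state, to a
   limit.  If the limit violated the Bellman optimality inequality at [(s, b)], the
   advantage of [b] at [s] would stay above some [Delta > 0].  As [e^(-theta) pi = 1 / Z],
   the increments of [e^(-theta(s,a))] are at most a constant times [1 / Z], while those of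
   [e^(-theta(s,b))] are at most a negative constant times [1 / Z], with a common factor;
   hence all [theta(s,.)] are bounded below, and above since their sum is constant.  Then
   [pi(b|s)] stays away from [0], and so does the gradient, which is impossible since each
   step gains [eta / 2 * |grad|].  So the limit is optimal, and uniqueness of the optimal
   actions forces [pi(astar s|s)] to tend to [1]. *)

(** * Discounted sums and visitation distributions *)

Lemma cvg_sumr (R : realType) (I : Type) (T : Type) (F : set_system T)
    (FF : Filter F) (s : seq I) (f : I -> T -> R) (l : I -> R) :
  (forall i, f i x @[x --> F] --> l i)%classic ->
  (\sum_(i <- s) f i x @[x --> F] --> \sum_(i <- s) l i)%classic.
Proof.
move=> fl; elim: s => [|i s IH].
  rewrite big_nil; under eq_fun do rewrite big_nil; exact: cvg_cst.
by rewrite big_cons; under eq_fun do rewrite big_cons; exact: cvgD.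
Qed.

Lemma sum_pred1 (R : pzRingType) (I : finType) (i : I) (f : I -> R) :
  \sum_j (if j == i then 1 else 0) * f j = f i.
Proof.
rewrite (bigD1 i) //= eqxx mul1r big1 ?addr0 // => j /negbTE ->.
by rewrite mul0r.
Qed.

Section Discounted.
Variables (R : realType) (gamma : R).
Hypothesis gamma01 : 0 <= gamma < 1.

(** Common form of the series behind [Vfun] and [dvis]; for sequences in [0,1] it converges by
    comparison with a geometric series. *)
Definition discounted (u : nat -> R) : R := limn (series (fun t => gamma ^+ t * u t)).

Definition bounded01 (u : nat -> R) := forall t, 0 <= u t <= 1.

Lemma is_cvg_discounted u : bounded01 u -> cvgn (series (fun t => gamma ^+ t * u t)).
Proof.
case/andP: gamma01 => g0 g1 u01.
apply: (@series_le_cvg _ _ (geometric 1 gamma)).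
- by move=> n; rewrite mulr_ge0 ?exprn_ge0 //; case/andP: (u01 n).
- by move=> n; rewrite /= mul1r exprn_ge0.
- by move=> n; rewrite /= mul1r ler_piMr ?exprn_ge0 //; case/andP: (u01 n).
- by apply: is_cvg_geometric_series; rewrite ger0_norm.
Qed.

Lemma discounted_ge0 u : bounded01 u -> 0 <= discounted u.
Proof.
case/andP: gamma01 => g0 _ u01; apply: limr_ge; first exact: is_cvg_discounted.
apply: nearW => n; rewrite /series /=; apply: sumr_ge0 => i _.
by rewrite mulr_ge0 ?exprn_ge0 //; case/andP: (u01 i).
Qed.

Lemma discounted_sum (I : finType) (c : I -> R) (u : I -> nat -> R) :
  (forall i, bounded01 (u i)) ->
  discounted (fun t => \sum_i c i * u i t) = \sum_i c i * discounted (u i).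
Proof.
move=> u01; apply/cvg_lim => //.
have -> : series (fun t => gamma ^+ t * \sum_i c i * u i t) =
    (fun n => \sum_i c i * series (fun t => gamma ^+ t * u i t) n).
  apply/funext => n; rewrite /series /=.
  under [RHS]eq_bigr do rewrite mulr_sumr.
  rewrite exchange_big /=; apply: eq_bigr => t _.
  by rewrite mulr_sumr; apply: eq_bigr => i _; rewrite mulrCA.
apply: cvg_sumr => i; apply: cvgZl_tmp; exact: is_cvg_discounted.
Qed.

Lemma discounted_rec u : bounded01 u ->
  discounted u = u 0%N + gamma * discounted (fun t => u t.+1).
Proof.
move=> u01; apply/cvg_lim => //; rewrite -cvg_shiftS /=.
have -> : (fun n => series (fun t => gamma ^+ t * u t) n.+1) =
    (fun n => u 0%N + gamma * series (fun t => gamma ^+ t * u t.+1) n).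
  apply/funext => n; rewrite /series /= big_nat_recl // expr0 mul1r; congr (_ + _).
  by rewrite mulr_sumr; apply: eq_bigr => i _; rewrite exprS mulrA.
apply: cvgD; first exact: cvg_cst.
by apply: cvgZl_tmp; apply: is_cvg_discounted => t; exact: u01.
Qed.

Lemma eq_discounted u v : u =1 v -> discounted u = discounted v.
Proof. by move=> /funext ->. Qed.

End Discounted.

(** * Visitation, value and advantage of a fixed policy *)

Section Dynamics.
Variables (R : realType) (St Ac : finType).
Variables (P : St -> Ac -> St -> R) (r : St -> Ac -> R) (gamma : R).
Hypothesis mdpP : is_mdp P r gamma.
Implicit Types (pi : St -> Ac -> R) (nu : St -> R) (s : St) (a : Ac).

Lemma mdp_gamma01 : 0 <= gamma < 1. Proof. by case: mdpP => _ [_ [_ ->]]. Qed.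

Lemma mdp_gamma_ge0 : 0 <= gamma. Proof. by case/andP: mdp_gamma01. Qed.

Lemma mdp_1gamma_gt0 : 0 < 1 - gamma.
Proof. by rewrite subr_gt0; case/andP: mdp_gamma01. Qed.

Local Notation g01 := mdp_gamma01.

Lemma Ppi_ge0 pi s s' : is_policy pi -> 0 <= Ppi P pi s s'.
Proof.
by case: mdpP => P0 _ [p0 _]; apply: sumr_ge0 => a _; rewrite mulr_ge0.
Qed.

Lemma Ppi_sum1 pi s : is_policy pi -> \sum_s' Ppi P pi s s' = 1.
Proof.
case: mdpP => _ [P1 _] [_ p1]; rewrite /Ppi exchange_big /= -(p1 s).
by apply: eq_bigr => a _; rewrite -mulr_sumr P1 mulr1.
Qed.

Definition push pi nu : St -> R := fun s' => \sum_s nu s * Ppi P pi s s'.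

Lemma push_distr pi nu : is_policy pi -> is_distr nu -> is_distr (push pi nu).
Proof.
move=> hpi [n0 n1]; split=> [s|].
  by apply: sumr_ge0 => s' _; rewrite mulr_ge0 // Ppi_ge0.
rewrite /push exchange_big /= -n1; apply: eq_bigr => s _.
by rewrite -mulr_sumr Ppi_sum1 // mulr1.
Qed.

Lemma dirac_distr s : is_distr (dirac_st R s).
Proof.
split=> [s'|]; first by rewrite /dirac_st; case: ifP.
have := sum_pred1 s (fun=> 1 : R).
by under eq_bigr do rewrite mulr1.
Qed.

Lemma push_dirac pi s : push pi (dirac_st R s) = Ppi P pi s.
Proof. by apply/funext => s'; rewrite /push /dirac_st sum_pred1. Qed.

(** [stdist] appends transitions at the end; moving the first one into the initial distribution
    makes a first-step decomposition possible. *)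
Lemma stdistS pi nu t : stdist P pi nu t.+1 = stdist P pi (push pi nu) t.
Proof. by elim: t => // t IH; rewrite -[LHS]/(push pi (stdist P pi nu t.+1)) IH. Qed.

Lemma stdist_distr pi nu t :
  is_policy pi -> is_distr nu -> is_distr (stdist P pi nu t).
Proof. by move=> hpi hnu; elim: t => //= t IH; exact: push_distr. Qed.

Lemma distr_le1 nu s : is_distr nu -> nu s <= 1.
Proof. by case=> n0 <-; rewrite (bigD1 s) //= lerDl sumr_ge0. Qed.

Lemma stdist01 pi nu s : is_policy pi -> is_distr nu ->
  bounded01 (fun t => stdist P pi nu t s).
Proof.
move=> hpi hnu t; have h := stdist_distr t hpi hnu.
by rewrite distr_le1 // andbT; case: h.
Qed.

Lemma stdist_mix pi nu t s :
  stdist P pi nu t s = \sum_s0 nu s0 * stdist P pi (dirac_st R s0) t s.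
Proof.
elim: t s => [|t IH] s /=.
  rewrite /dirac_st -[LHS](sum_pred1 s nu); apply: eq_bigr => i _.
  by rewrite mulrC eq_sym.
under eq_bigr do rewrite IH mulr_suml.
rewrite exchange_big; apply: eq_bigr => i _ /=.
by rewrite mulr_sumr; apply: eq_bigr => j _; rewrite mulrA.
Qed.

Lemma dvis_discounted pi nu s :
  dvis P gamma pi nu s = (1 - gamma) * discounted gamma (fun t => stdist P pi nu t s).
Proof. by []. Qed.

Lemma dvis_mix pi nu s : is_policy pi ->
  dvis P gamma pi nu s = \sum_s0 nu s0 * dvis P gamma pi (dirac_st R s0) s.
Proof.
move=> hpi; rewrite dvis_discounted.
under eq_discounted do rewrite stdist_mix.
rewrite discounted_sum ?mulr_sumr; last first.
- by move=> i; apply: stdist01 => //; exact: dirac_distr.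
- exact: g01.
by apply: eq_bigr => i _; rewrite dvis_discounted mulrCA.
Qed.

Lemma dvis_ge0 pi nu s : is_policy pi -> is_distr nu -> 0 <= dvis P gamma pi nu s.
Proof.
move=> hpi hnu; rewrite dvis_discounted.
apply: mulr_ge0; first exact/ltW/mdp_1gamma_gt0.
by apply: discounted_ge0; [exact: g01|exact: stdist01].
Qed.

(** The last transition is split off each term of the series; [dvis_backward] splits off the first
    one. *)
Lemma dvis_flow pi nu s : is_policy pi -> is_distr nu ->
  dvis P gamma pi nu s =
  (1 - gamma) * nu s + gamma * \sum_s' dvis P gamma pi nu s' * Ppi P pi s' s.
Proof.
move=> hpi hnu; rewrite dvis_discounted discounted_rec; last first.
- exact: stdist01.
- exact: g01.
rewrite mulrDr; congr (_ + _); rewrite /=.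
under eq_discounted do under eq_bigr do rewrite mulrC.
rewrite discounted_sum; last first.
- by move=> i; exact: stdist01.
- exact: g01.
rewrite mulrCA mulr_sumr; congr (_ * _); apply: eq_bigr => i _.
by rewrite dvis_discounted mulrAC mulrA mulrAC.
Qed.

Lemma dvis_backward pi s s1 : is_policy pi ->
  dvis P gamma pi (dirac_st R s) s1 =
  (1 - gamma) * dirac_st R s s1
  + gamma * \sum_s' Ppi P pi s s' * dvis P gamma pi (dirac_st R s') s1.
Proof.
move=> hpi; have hs := dirac_distr s.
rewrite dvis_discounted discounted_rec; last first.
- exact: stdist01.
- exact: g01.
rewrite mulrDr; congr (_ + _); rewrite mulrCA; congr (_ * _).
under eq_discounted do rewrite stdistS push_dirac.
by rewrite -dvis_discounted dvis_mix.
Qed.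

Lemma dvis_sum1 pi nu : is_policy pi -> is_distr nu -> \sum_s dvis P gamma pi nu s = 1.
Proof.
move=> hpi hnu; have g0 := mdp_1gamma_gt0.
have : \sum_s dvis P gamma pi nu s = (1 - gamma) + gamma * \sum_s dvis P gamma pi nu s.
  under [LHS]eq_bigr do rewrite dvis_flow //.
  rewrite big_split /= -[X in X + _]mulr_sumr -[X in _ + X = _]mulr_sumr.
  case: (hnu) => _ ->; rewrite mulr1; congr (_ + _ * _).
  rewrite exchange_big /=; apply: eq_bigr => s _.
  by rewrite -mulr_sumr Ppi_sum1 // mulr1.
move=> E; apply/(mulfI (lt0r_neq0 g0)); lra.
Qed.

Lemma dvis_distr pi nu : is_policy pi -> is_distr nu -> is_distr (dvis P gamma pi nu).
Proof. by move=> hpi hnu; split=> [s|]; [exact: dvis_ge0|exact: dvis_sum1]. Qed.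

Lemma dvis_ge pi nu s : is_policy pi -> is_distr nu ->
  (1 - gamma) * nu s <= dvis P gamma pi nu s.
Proof.
move=> hpi hnu; rewrite (dvis_flow _ hpi hnu) lerDl mulr_ge0 ?mdp_gamma_ge0 //.
by apply: sumr_ge0 => i _; rewrite mulr_ge0 ?dvis_ge0 ?Ppi_ge0.
Qed.

(* Every comparison between two policies below is an instance of this identity. *)
Lemma dvis_resolvent pi nu (f : St -> R) : is_policy pi -> is_distr nu ->
  (1 - gamma) * \sum_s nu s * f s =
  \sum_s dvis P gamma pi nu s * (f s - gamma * \sum_s' Ppi P pi s s' * f s').
Proof.
move=> hpi hnu.
under [RHS]eq_bigr do rewrite mulrBr.
rewrite big_split /= sumrN.
under [X in _ = X - _]eq_bigr => s _ do rewrite (dvis_flow _ hpi hnu) mulrDl -!mulrA.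
rewrite big_split /= -[X in _ = X + _ - _]mulr_sumr -[X in _ = _ + X - _]mulr_sumr.
rewrite -addrA [X in _ = _ + X](_ : _ = 0) ?addr0 //.
apply/eqP; rewrite subr_eq0; apply/eqP.
under [RHS]eq_bigr do rewrite mulrCA.
rewrite -mulr_sumr; congr (_ * _).
under eq_bigr do rewrite mulr_suml.
rewrite exchange_big /=; apply: eq_bigr => s _.
by rewrite mulr_sumr; apply: eq_bigr => s' _; rewrite mulrA.
Qed.

Definition rpi pi s := \sum_a pi s a * r s a.

Lemma rpi01 pi s : is_policy pi -> 0 <= rpi pi s <= 1.
Proof.
case=> p0 p1; case: mdpP => _ [_ [r01 _]]; apply/andP; split.
  by apply: sumr_ge0 => a _; rewrite mulr_ge0 //; case/andP: (r01 s a).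
by rewrite -(p1 s); apply: ler_sum => a _; rewrite ler_piMr //; case/andP: (r01 s a).
Qed.

(** Exchanging the sums over time and over states turns the value into an average reward under
    [dvis]; the Bellman equation and the bounds on [Vfun] are read off from it. *)
Lemma Vfun_dvis pi s : is_policy pi ->
  (1 - gamma) * Vfun P r gamma pi s =
  \sum_s' rpi pi s' * dvis P gamma pi (dirac_st R s) s'.
Proof.
move=> hpi; rewrite /Vfun -/(discounted gamma _) /exp_reward.
under eq_discounted do under eq_bigr do rewrite mulrC.
rewrite discounted_sum; last first.
- by move=> i; apply: stdist01 => //; exact: dirac_distr.
- exact: g01.
rewrite mulr_sumr; apply: eq_bigr => i _; rewrite dvis_discounted /rpi.
by rewrite mulrCA.
Qed.

Lemma Vfun_bellman pi s : is_policy pi ->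
  Vfun P r gamma pi s = \sum_a pi s a * Qfun P r gamma pi s a.
Proof.
move=> hpi; have g0 := lt0r_neq0 mdp_1gamma_gt0.
apply: (mulfI g0); rewrite Vfun_dvis //.
under eq_bigr do rewrite dvis_backward // mulrDr.
rewrite big_split /=.
have -> : \sum_i rpi pi i * ((1 - gamma) * dirac_st R s i) = (1 - gamma) * rpi pi s.
  rewrite -[X in _ * X](sum_pred1 s (rpi pi)) mulr_sumr; apply: eq_bigr => i _.
  by rewrite mulrCA; congr (_ * _); rewrite mulrC.
under [X in _ + X]eq_bigr do rewrite mulrCA mulr_sumr.
rewrite -mulr_sumr exchange_big /= /Qfun.
under [X in _ = _ * X]eq_bigr do rewrite mulrDr.
rewrite big_split /= mulrDr; congr (_ + _).
have -> : \sum_(j : St) \sum_(i : St) rpi pi i *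
     (Ppi P pi s j * dvis P gamma pi (dirac_st R j) i) =
   \sum_(j : St) Ppi P pi s j * ((1 - gamma) * Vfun P r gamma pi j).
  apply: eq_bigr => j _; rewrite Vfun_dvis // mulr_sumr.
  by apply: eq_bigr => i _; rewrite mulrCA.
rewrite /Ppi; under [X in _ * X = _]eq_bigr do rewrite mulr_suml.
rewrite exchange_big /= !mulr_sumr; apply: eq_bigr => a _.
rewrite !mulr_sumr; apply: eq_bigr => j _; ring.
Qed.

Definition adv pi s a := Qfun P r gamma pi s a - Vfun P r gamma pi s.

Lemma adv_mean0 pi s : is_policy pi -> \sum_a pi s a * adv pi s a = 0.
Proof.
move=> hpi; case: (hpi) => _ p1; under eq_bigr do rewrite mulrBr.
by rewrite big_split /= sumrN -mulr_suml p1 mul1r -Vfun_bellman // subrr.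
Qed.

(** Performance difference identity: [dvis_resolvent] for [pi'], applied to the difference of the
    two value functions. By the Bellman equation for [pi'] the bracket there is the mean under [pi']
    of the advantage of [pi]. *)
Lemma Vnu_diff pi pi' nu : is_policy pi -> is_policy pi' -> is_distr nu ->
  (1 - gamma) * (Vnu P r gamma pi' nu - Vnu P r gamma pi nu) =
  \sum_s dvis P gamma pi' nu s * \sum_a pi' s a * adv pi s a.
Proof.
move=> hpi hpi' hnu; rewrite /Vnu -sumrB.
under eq_bigr do rewrite -mulrBr.
rewrite (dvis_resolvent _ hpi' hnu); apply: eq_bigr => s _; congr (_ * _).
rewrite (Vfun_bellman _ hpi') /adv.
under [RHS]eq_bigr do rewrite mulrBr.
rewrite [RHS]big_split /= sumrN -mulr_suml; case: (hpi') => _ ->; rewrite mul1r.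
rewrite addrAC; congr (_ - _).
rewrite /Ppi; under [X in _ - gamma * X]eq_bigr do rewrite mulr_suml.
rewrite exchange_big /= mulr_sumr -sumrB; apply: eq_bigr => a _.
rewrite /Qfun; have -> : \sum_(j : St) pi' s a * P s a j *
      (Vfun P r gamma pi' j - Vfun P r gamma pi j) =
   pi' s a * (\sum_s' P s a s' * Vfun P r gamma pi' s'
              - \sum_s' P s a s' * Vfun P r gamma pi s').
  by rewrite -sumrB mulr_sumr; apply: eq_bigr => j _; ring.
ring.
Qed.

Lemma Vnu_dirac pi s : Vnu P r gamma pi (dirac_st R s) = Vfun P r gamma pi s.
Proof. exact: sum_pred1. Qed.

Lemma Vfun_ge0 pi s : is_policy pi -> 0 <= Vfun P r gamma pi s.
Proof.
move=> hpi; rewrite -(pmulr_rge0 _ mdp_1gamma_gt0) Vfun_dvis //.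
apply: sumr_ge0 => i _; rewrite mulr_ge0 ?dvis_ge0 //; last exact: dirac_distr.
by case/andP: (rpi01 i hpi).
Qed.

Lemma Vfun_le pi s : is_policy pi -> Vfun P r gamma pi s <= (1 - gamma)^-1.
Proof.
move=> hpi; rewrite -(ler_pM2l mdp_1gamma_gt0) Vfun_dvis //.
rewrite mulfV ?lt0r_neq0 ?mdp_1gamma_gt0 //.
rewrite -(dvis_sum1 hpi (dirac_distr s)); apply: ler_sum => i _.
rewrite ler_piMl ?dvis_ge0 //; first exact: dirac_distr.
by case/andP: (rpi01 i hpi).
Qed.

Lemma Qfun_ge0 pi s a : is_policy pi -> 0 <= Qfun P r gamma pi s a.
Proof.
case: mdpP => P0 [_ [r01 _]] hpi.
rewrite addr_ge0 ?mulr_ge0 ?mdp_gamma_ge0 ?sumr_ge0 //.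
  by case/andP: (r01 s a).
by move=> s' _; rewrite mulr_ge0 ?Vfun_ge0.
Qed.

Lemma adv_ge pi s a : is_policy pi -> - (1 - gamma)^-1 <= adv pi s a.
Proof.
move=> hpi; have := Vfun_le s hpi; have := Qfun_ge0 s a hpi; rewrite /adv.
by set x := _^-1; lra.
Qed.

End Dynamics.

(** * Visitation distributions of nearby policies *)

Section Concentrability.
Variables (R : realType) (St : finType).
Implicit Types (f mu : St -> R) (s : St).

Lemma ratio_inf_ub f mu s : 0 < mu s -> f s <= ratio_inf f mu * mu s.
Proof.
by move=> m0; rewrite -ler_pdivrMr //; exact: (le_bigmax _ (fun i => f i / mu i)).
Qed.

Lemma ratio_inf_le f mu M : (forall s, 0 < mu s) -> 0 <= M ->
  (forall s, f s <= M * mu s) -> ratio_inf f mu <= M.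
Proof. by move=> m0 M0 fM; apply: bigmax_le => // s _; rewrite ler_pdivrMr. Qed.

Lemma ratio_inf_ge0 f mu : 0 <= ratio_inf f mu.
Proof. exact: bigmax_ge_id. Qed.

End Concentrability.

Section Comparison.
Variables (R : realType) (St Ac : finType).
Variables (P : St -> Ac -> St -> R) (r : St -> Ac -> R) (gamma : R).
Hypothesis mdpP : is_mdp P r gamma.
Variable mu : St -> R.
Hypothesis mu_distr : is_distr mu.
Hypothesis mu_gt0 : forall s, 0 < mu s.
Implicit Types (pi : St -> Ac -> R) (nu : St -> R) (s : St) (a : Ac).

Lemma dvis_le_Cinf pi nu s : is_policy pi -> is_distr nu ->
  dvis P gamma pi nu s <= Cinf P gamma nu mu * mu s.
Proof.
move=> hpi hnu; apply: (le_trans (ratio_inf_ub _ (mu_gt0 s))).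
rewrite ler_wpM2r ?(ltW (mu_gt0 s)) // /Cinf; set E := [set x | _]%classic.
have Eub : has_ubound E; last by have /ubP := ub_le_sup Eub; apply; exists pi.
(* Visitation probabilities are at most 1, so the ratio of the constant 1 bounds the set whose
   supremum is taken. *)
exists (ratio_inf (fun=> 1) mu) => x /= [pi1 [hpi1 ->]].
apply: ratio_inf_le => // [|s1]; first exact: ratio_inf_ge0.
apply: le_trans (ratio_inf_ub (fun=> 1) (mu_gt0 s1)).
exact/distr_le1/(dvis_distr mdpP).
Qed.

Lemma Cinf_ge pi s : is_policy pi -> 1 - gamma <= Cinf P gamma mu mu.
Proof.
move=> hpi; rewrite -(ler_pM2r (mu_gt0 s)).
apply: le_trans (dvis_le_Cinf s hpi mu_distr).
exact: (dvis_ge mdpP).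
Qed.

(** [dvis_resolvent] for [pi] is applied to [f s0], the visitation of [s] under [pi'] from [s0].
    Since [f] solves the backward equation of [pi'], only the difference of the two kernels remains,
    and it is at most [eps * Ppi P pi]. By the flow equation, [gamma] times the image of [d] is
    [d - (1 - gamma) * mu], hence at most the excess of [Cinf] times [mu]; averaging [f] over [mu]
    gives back [d' s]. *)
Lemma dvis_compare pi pi' eps s : is_policy pi -> is_policy pi' ->
  (forall s a, `|pi' s a - pi s a| <= eps * pi s a) ->
  (1 - gamma) * `|dvis P gamma pi' mu s - dvis P gamma pi mu s| <=
  eps * (Cinf P gamma mu mu - (1 - gamma)) * dvis P gamma pi' mu s.
Proof.
move=> hpi hpi' close; set d := dvis P gamma pi mu; set d' := dvis P gamma pi' mu.
pose f s0 := dvis P gamma pi' (dirac_st R s0) s.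
have f0 s0 : 0 <= f s0 by apply: (dvis_ge0 mdpP) => //; exact: dirac_distr.
have muf : \sum_s0 mu s0 * f s0 = d' s by rewrite /d' (dvis_mix mdpP).
have eps0 s0 s1 : 0 <= eps * Ppi P pi s0 s1.
  rewrite mulr_sumr; apply: sumr_ge0 => a _; rewrite mulrA mulr_ge0 //.
    exact: le_trans (close s0 a).
  by case: mdpP.
have dP s0 s1 : `|Ppi P pi' s0 s1 - Ppi P pi s0 s1| <= eps * Ppi P pi s0 s1.
  rewrite /Ppi -sumrB mulr_sumr; apply: (le_trans (ler_norm_sum _ _ _)).
  apply: ler_sum => a _; have P0 : 0 <= P s0 a s1 by case: mdpP.
  by rewrite -mulrBl normrM (ger0_norm P0) mulrA ler_wpM2r.
have d0 s0 : 0 <= d s0 by exact: (dvis_ge0 mdpP).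
have := dvis_resolvent mdpP f hpi mu_distr; rewrite muf -/d.
have -> : \sum_s0 d s0 * (f s0 - gamma * \sum_s' Ppi P pi s0 s' * f s') =
   (1 - gamma) * d s
   + gamma * \sum_s0 d s0 * \sum_s' (Ppi P pi' s0 s' - Ppi P pi s0 s') * f s'.
  have -> : d s = \sum_s0 (if s0 == s then 1 else 0) * d s0 by rewrite sum_pred1.
  rewrite !mulr_sumr -big_split /=; apply: eq_bigr => s0 _.
  rewrite {1}/f (dvis_backward mdpP) // -/(f _) /dirac_st (eq_sym s).
  under [X in gamma * (_ * X)]eq_bigr do rewrite mulrBl.
  rewrite sumrB.
  have -> : \sum_s' Ppi P pi' s0 s' * dvis P gamma pi' (fun s'0 => if s'0 == s' then 1 else 0) s
    = \sum_i Ppi P pi' s0 i * f i by [].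
  set X := \sum_i Ppi P pi' s0 i * f i; set Y := \sum_i Ppi P pi s0 i * f i.
  by case: ifP => _; ring.
move=> E; have {}E : (1 - gamma) * (d' s - d s) =
   gamma * \sum_s0 d s0 * \sum_s' (Ppi P pi' s0 s' - Ppi P pi s0 s') * f s'.
  by rewrite mulrBr E addrC addKr.
rewrite -[X in X * `|_|]gtr0_norm ?(mdp_1gamma_gt0 mdpP) // -normrM E normrM.
rewrite ger0_norm ?(mdp_gamma_ge0 mdpP) //.
apply: (@le_trans _ _ (eps * \sum_s' (gamma * \sum_s0 d s0 * Ppi P pi s0 s') * f s')).
  have -> : eps * \sum_s' (gamma * \sum_s0 d s0 * Ppi P pi s0 s') * f s' =
    gamma * \sum_s0 d s0 * \sum_s' (eps * Ppi P pi s0 s') * f s'.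
    under [in RHS]eq_bigr do rewrite mulr_sumr.
    rewrite exchange_big /= !mulr_sumr; apply: eq_bigr => s' _.
    rewrite mulr_sumr !mulr_suml !mulr_sumr; apply: eq_bigr => s0 _; ring.
  rewrite ler_wpM2l ?(mdp_gamma_ge0 mdpP) //.
  apply: (le_trans (ler_norm_sum _ _ _)); apply: ler_sum => s0 _.
  rewrite normrM ger0_norm // ler_wpM2l //.
  apply: (le_trans (ler_norm_sum _ _ _)); apply: ler_sum => s' _.
  by rewrite normrM (ger0_norm (f0 s')) ler_wpM2r.
have -> : eps * (Cinf P gamma mu mu - (1 - gamma)) * d' s =
   \sum_s' (eps * (Cinf P gamma mu mu - (1 - gamma))) * (mu s' * f s').
  by rewrite -mulr_sumr muf.
rewrite mulr_sumr; apply: ler_sum => s' _.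
have -> : gamma * \sum_s0 d s0 * Ppi P pi s0 s' = d s' - (1 - gamma) * mu s'.
  by rewrite {2}/d (dvis_flow mdpP) // addrC addKr.
(* A negative [eps] contradicts [eps0], since the rows of [Ppi] sum to 1. *)
have [e0|e0] := ltP eps 0.
  have := eps0 s' s'; have := dvis_le_Cinf s' hpi mu_distr; rewrite -/d => h1 _.
  have : \sum_s1 eps * Ppi P pi s' s1 = eps.
    by rewrite -mulr_sumr (Ppi_sum1 mdpP) ?mulr1.
  have : 0 <= \sum_s1 eps * Ppi P pi s' s1 by apply: sumr_ge0.
  by move=> h2 h3; move: h2; rewrite h3 leNgt e0.
rewrite -mulrA ler_wpM2l // mulrA ler_wpM2r // [leRHS]mulrBl lerD2r.
exact: dvis_le_Cinf.
Qed.

End Comparison.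

(** * Exponential tilts of softmax policies *)

Section Softmax.
Variables (R : realType) (St Ac : finType).
Implicit Types (theta x A : St -> Ac -> R) (s : St) (a : Ac).

Lemma sum_expR_gt0 theta s a : 0 < \sum_a' expR (theta s a').
Proof.
by rewrite (bigD1 a) //= ltr_wpDr ?expR_gt0 // sumr_ge0 // => i _; exact: expR_ge0.
Qed.

Lemma softmax_gt0 theta s a : 0 < softmax theta s a.
Proof. by rewrite divr_gt0 ?expR_gt0 ?(sum_expR_gt0 _ _ a). Qed.

(** The map [f] supplies an action at each state, which makes the normalizer positive. *)
Lemma softmax_policy (f : St -> Ac) theta : is_policy (softmax theta).
Proof.
split=> [s a|s]; first exact/ltW/softmax_gt0.
by rewrite /softmax -mulr_suml divff // lt0r_neq0 // (sum_expR_gt0 _ _ (f s)).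
Qed.

Definition tilt_norm theta x s := \sum_a softmax theta s a * expR (x s a).

Lemma softmaxD theta x s a :
  softmax (fun s a => theta s a + x s a) s a =
  softmax theta s a * expR (x s a) / tilt_norm theta x s.
Proof.
rewrite /tilt_norm /softmax expRD.
have -> : \sum_a0 expR (theta s a0) / (\sum_a' expR (theta s a')) * expR (x s a0)
  = (\sum_a0 expR (theta s a0 + x s a0)) / \sum_a' expR (theta s a').
  by rewrite mulr_suml; apply: eq_bigr => i _; rewrite expRD mulrAC.
have z0 := lt0r_neq0 (sum_expR_gt0 theta s a).
have w0 := lt0r_neq0 (sum_expR_gt0 (fun s a => theta s a + x s a) s a).
by field; rewrite z0.
Qed.

Lemma tilt_norm_bounds theta x s h (f : St -> Ac) : (forall a, `|x s a| <= h) ->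
  expR (- h) <= tilt_norm theta x s <= expR h.
Proof.
move=> xh; have [p0 p1] := softmax_policy f theta.
apply/andP; split.
  rewrite -[leLHS]mul1r -(p1 s) mulr_suml; apply: ler_sum => a _.
  by rewrite ler_wpM2l // ler_expR; have := xh a; rewrite ler_norml => /andP[].
rewrite -[leRHS]mul1r -(p1 s) mulr_suml; apply: ler_sum => a _.
by rewrite ler_wpM2l // ler_expR; have := xh a; rewrite ler_norml => /andP[].
Qed.

Lemma tilt_norm_gt0 theta x s a : 0 < tilt_norm theta x s.
Proof.
have p0 a' := softmax_gt0 theta s a'.
rewrite /tilt_norm (bigD1 a) //= ltr_wpDr //; last by rewrite mulr_gt0 ?expR_gt0.
by rewrite sumr_ge0 // => i _; rewrite mulr_ge0 ?expR_ge0 // ltW.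
Qed.

(** The ratio of new to old probability is [expR (x s a) / Z] with both factors within [expR h] of
    1, so it lies between [1 / e] and [e] for [e = expR (h *+ 2)]; the lower side is covered by
    [1 - 1 / e <= e - 1]. *)
Lemma softmaxD_close theta x h : (forall s a, `|x s a| <= h) -> forall s a,
  `|softmax (fun s a => theta s a + x s a) s a - softmax theta s a| <=
  (expR (h *+ 2) - 1) * softmax theta s a.
Proof.
move=> xh s a; rewrite softmaxD.
set p := softmax theta s a; have p0 : 0 < p by exact: softmax_gt0.
have [zl zu] : expR (- h) <= tilt_norm theta x s /\ tilt_norm theta x s <= expR h.
  exact/andP/(tilt_norm_bounds _ (fun=> a))/xh.
set Z := tilt_norm _ _ _ in zl zu *; have Z0 : 0 < Z by exact: tilt_norm_gt0.
have [xl xu] : expR (- h) <= expR (x s a) /\ expR (x s a) <= expR h.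
  by rewrite !ler_expR; have := xh s a; rewrite ler_norml => /andP[].
rewrite -mulrA -{2}[p]mulr1 -mulrBr normrM gtr0_norm // [leLHS]mulrC ler_wpM2r ?(ltW p0) //.
have E : expR (h *+ 2) = expR h / expR (- h) by rewrite -expRB opprK mulr2n.
have E' : (expR (h *+ 2))^-1 = expR (- h) / expR h by rewrite E invf_div.
set e := expR (h *+ 2) in E E' *.
have e0 : 0 < e by exact: expR_gt0.
have up : expR (x s a) / Z <= e.
  rewrite E ler_pM ?invr_ge0 ?expR_ge0 ?(ltW Z0) //.
  by rewrite lef_pV2 ?posrE ?expR_gt0.
have lo : e^-1 <= expR (x s a) / Z.
  rewrite E' ler_pM ?invr_ge0 ?expR_ge0 //.
  by rewrite lef_pV2 ?posrE ?expR_gt0.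
have : 1 - e^-1 <= e - 1.
  rewrite -(ler_pM2r e0) mulrBl mulVf ?lt0r_neq0 //.
  by have := sqr_ge0 (e - 1); nra.
rewrite ler_norml; lra.
Qed.

Lemma softmaxD_mean theta x A s : \sum_a softmax theta s a * A s a = 0 ->
  \sum_a softmax (fun s a => theta s a + x s a) s a * A s a =
  (\sum_a softmax theta s a * A s a * (expR (x s a) - 1)) / tilt_norm theta x s.
Proof.
move=> m0; under [in RHS]eq_bigr do rewrite mulrBr mulr1.
rewrite sumrB m0 subr0 mulr_suml; apply: eq_bigr => a _.
by rewrite softmaxD; ring.
Qed.

End Softmax.

(** * Policy gradient *)

Lemma expR_ge1 (R : realType) (x : R) : 0 <= x -> 1 <= expR x.
Proof. by move=> x0; rewrite -[leLHS]expR0 ler_expR. Qed.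

Section PolicyGradient.
Variables (R : realType) (St Ac : finType).
Variables (P : St -> Ac -> St -> R) (r : St -> Ac -> R) (gamma : R).
Hypothesis mdpP : is_mdp P r gamma.
Variable mu : St -> R.
Hypothesis mu_distr : is_distr mu.
Hypothesis mu_gt0 : forall s, 0 < mu s.
Implicit Types (theta x : St -> Ac -> R) (s : St) (a : Ac).
Variable act : St -> Ac.

Local Notation q := (1 - gamma).
Local Notation V := (Vnu P r gamma).
Local Notation d := (dvis P gamma).
Local Notation policy := (softmax_policy act).

Let q0 : 0 < q := mdp_1gamma_gt0 mdpP.

Lemma Vnu_softmaxD theta x nu : is_distr nu ->
  q * (V (softmax (fun s a => theta s a + x s a)) nu - V (softmax theta) nu) =
  \sum_s d (softmax (fun s a => theta s a + x s a)) nu s *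
    ((\sum_a softmax theta s a * adv P r gamma (softmax theta) s a * (expR (x s a) - 1))
     / tilt_norm theta x s).
Proof.
move=> hnu; rewrite (Vnu_diff mdpP) //; try exact: policy.
apply: eq_bigr => s _; rewrite softmaxD_mean //.
exact/(adv_mean0 mdpP)/policy.
Qed.

Lemma cvg_expR_slope : (h^-1 * (expR h - 1) @[h --> 0^'] --> (1 : R))%classic.
Proof.
have [c e] := is_derive_expR (0 : R).
move: c e; rewrite /derivable /derive expR0 => c e.
rewrite -[X in (_ --> X)%classic]e.
have -> : (fun h : R => h^-1 * (expR h - 1)) =
   (fun h => h^-1 *: (expR (h *: 1 + 0) - 1)).
  by apply/funext => h; rewrite addr0 -[h *: 1]/(h * 1) mulr1.
exact: c.
Qed.

(** Squeeze: moving one logit by [h] changes probabilities by a relative factor at most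
    [expR (2 * |h|) - 1], which [dvis_compare] carries over to visitations. *)
Lemma cvg_dvis_perturb theta s a s1 :
  (d (softmax (perturb theta s a h)) mu s1 @[h --> 0^'] --> d (softmax theta) mu s1)%classic.
Proof.
pose x h s' a' : R := if (s' == s) && (a' == a) then h else 0.
set T := Cinf P gamma mu mu - q.
have T0 : 0 <= T by rewrite subr_ge0; apply: (Cinf_ge mdpP mu_distr mu_gt0 s (policy theta)).
pose b (h : R) := (T / q) * (expR (`|h| *+ 2) - 1).
have bE (h : R) : `|d (softmax (perturb theta s a h)) mu s1 - d (softmax theta) mu s1| <= b h.
  have xh s' a' : `|x h s' a'| <= `|h| by rewrite /x; case: ifP => // _; rewrite normr0.
  have := dvis_compare mdpP mu_distr mu_gt0 s1 (policy theta)
    (policy (perturb theta s a h)) (softmaxD_close theta xh).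
  rewrite -/T => H.
  rewrite -(ler_pM2l q0); apply: (le_trans H).
  have -> : q * b h = (expR (`|h| *+ 2) - 1) * T by rewrite /b; field; exact: lt0r_neq0.
  rewrite ler_piMr //.
    by rewrite mulr_ge0 // subr_ge0 expR_ge1 ?mulrn_wge0.
  by apply: distr_le1; exact/(dvis_distr mdpP)/mu_distr/policy.
have b0 : (b h @[h --> 0^'] --> (0 : R))%classic.
  suff : (b h @[h --> 0^'] --> (T / q) * (expR (`|0 : R| *+ 2) - 1))%classic.
    by rewrite normr0 mul0rn expR0 subrr mulr0.
  apply: cvgZl_tmp; apply: cvgB; last exact: cvg_cst.
  apply: (@continuous_cvg _ _ _ _ _ _ expR); first exact: continuous_expR.
  rewrite mulr2n; under eq_fun do rewrite mulr2n.
  have absh : (`|h| @[h --> (0 : R)^'] --> `|0 : R|)%classic.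
    by apply/continuous_withinNx; exact: norm_continuous.
  exact: (cvgD absh absh).
apply: (@squeeze_cvgr _ _ _ _ (fun h => d (softmax theta) mu s1 - b h)
   (fun h => d (softmax theta) mu s1 + b h)).
- by apply: nearW => h; have := bE h; rewrite ler_distl.
- by rewrite -[X in (_ --> X)%classic]subr0; apply: cvgB => //; exact: cvg_cst.
- by rewrite -[X in (_ --> X)%classic]addr0; apply: cvgD => //; exact: cvg_cst.
Qed.

(** The performance difference is exact for finite [h], and only the pair [(s, a)] contributes to
    it. The difference quotient is thus explicit, and its limit needs only the continuity of [dvis]
    and the slope of the exponential at 0. *)
Lemma policy_gradient theta s a :
  grad P r gamma mu theta s a =
  d (softmax theta) mu s * softmax theta s a * adv P r gamma (softmax theta) s a / q.
Proof.
set pi := softmax theta; set A := adv P r gamma pi.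
pose x h s' a' : R := if (s' == s) && (a' == a) then h else 0.
have p0 : perturb theta s a 0 = theta.
  by apply/funext => s'; apply/funext => a'; rewrite /perturb if_same addr0.
have ZE h : tilt_norm theta (x h) s = 1 + pi s a * (expR h - 1).
  rewrite /tilt_norm -[X in _ = X + _](proj2 (policy theta) s) -/pi.
  have -> : pi s a * (expR h - 1) =
      \sum_a' (if a' == a then 1 else 0) * (pi s a' * (expR h - 1)) by rewrite sum_pred1.
  rewrite -big_split /=; apply: eq_bigr => a' _; rewrite /x eqxx /= -/pi.
  by case: eqVneq => _; rewrite ?expR0; ring.
have diffE (h : R) : V (softmax (perturb theta s a h)) mu - V pi mu =
   q^-1 * (d (softmax (perturb theta s a h)) mu s
     * (pi s a * A s a * (expR h - 1) / (1 + pi s a * (expR h - 1)))).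
  apply: (mulfI (lt0r_neq0 q0)); rewrite [LHS](Vnu_softmaxD theta (x h) mu_distr).
  rewrite mulVKf ?lt0r_neq0 // (bigD1 s) //= [X in _ + X = _]big1 ?addr0; last first.
    move=> s' s's; rewrite big1 ?mul0r ?mulr0 // => a' _.
    by rewrite /x (negbTE s's) /= expR0 subrr mulr0.
  rewrite ZE -/pi -/A; congr (_ * (_ / _)).
  rewrite (bigD1 a) //= big1 ?addr0 => [|a' a'a]; first by rewrite /x !eqxx.
  by rewrite /x (negbTE a'a) andbF expR0 subrr mulr0.
rewrite /grad derive1E /derive; apply/cvg_lim => //.
have -> : (fun h : R => h^-1 *: (V (softmax (perturb theta s a (h *: 1 + 0))) mu
    - V (softmax (perturb theta s a 0)) mu)) =
  (fun h => (q^-1 * (pi s a * A s a)) * (d (softmax (perturb theta s a h)) mu s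
     * (h^-1 * (expR h - 1)) / (1 + pi s a * (expR h - 1)))).
  apply/funext => h; rewrite p0 addr0 -[h *: 1]/(h * 1) mulr1 diffE.
  by rewrite -[LHS]/(_ * _); ring.
have -> : d pi mu s * pi s a * A s a / q =
    (q^-1 * (pi s a * A s a)) * (d pi mu s * 1 / (1 + pi s a * (1 - 1))).
  by rewrite subrr mulr0 addr0 divr1; ring.
apply: cvgZl_tmp; apply: cvgM.
  by apply: cvgM; [exact: cvg_dvis_perturb|exact: cvg_expR_slope].
apply: cvgV; first by rewrite subrr mulr0 addr0 oner_neq0.
apply: cvgD; first exact: cvg_cst.
apply: cvgZl_tmp; apply: cvgB; last exact: cvg_cst.
by rewrite -[X in (_ --> X)%classic]expR0; apply/continuous_withinNx; exact: continuous_expR.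
Qed.

End PolicyGradient.

(** * One step of the method *)

(** For [x >= 0], [expR x - 1 >= x]. For [x < 0], [expR x - 1 <= x / (1 - x) <= x / (1 + h)], and
    [y <= 0] reverses the inequality. *)
Lemma tilt_gain (R : realType) (y x h : R) : 0 <= y * x -> `|x| <= h ->
  y * x / (1 + h) <= y * (expR x - 1).
Proof.
move=> yx0 xh; have h0 : 0 <= h by apply: le_trans xh.
have h1 : 0 < 1 + h by rewrite ltr_pwDl.
have [x0|x0|->] := ltgtP x 0; last by rewrite mulr0 mul0r expR0 subrr mulr0.
- have y0 : y <= 0 by rewrite -(ler_nM2r x0) mul0r.
  rewrite -mulrA ler_wnM2l // lerBlDr.
  have xh' : - x <= h by move: xh; rewrite ltr0_norm.
  have x1 : 0 < 1 - x by lra.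
  rewrite -[x in expR x]opprK expRN.
  have := expR_ge1Dx (- x) => ex.
  apply: (@le_trans _ _ (1 - x)^-1); first by rewrite lef_pV2 ?posrE ?expR_gt0.
  rewrite -(ler_pM2r x1) mulVf ?lt0r_neq0 // mulrDl mul1r mulrAC.
  rewrite -subr_ge0.
  have -> : x * (1 - x) / (1 + h) + (1 - x) - 1 = (- x) * (h + x) / (1 + h).
    by field; rewrite lt0r_neq0.
  by apply: divr_ge0; [apply: mulr_ge0; lra|exact: ltW].
- have y0 : 0 <= y by rewrite -(ler_pM2r x0) mul0r.
  rewrite -mulrA ler_wpM2l //; have := expR_ge1Dx x => ex.
  apply: (@le_trans _ _ x); last by lra.
  by rewrite ler_pdivrMr // ler_peMr ?(ltW x0) // lerDl.
Qed.

Lemma norm2_sq (R : realType) (St Ac : finType) (g : St -> Ac -> R) :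
  norm2 g ^+ 2 = \sum_s \sum_a g s a ^+ 2.
Proof.
by rewrite sqr_sqrtr //; apply: sumr_ge0 => s _; apply: sumr_ge0 => a _; exact: sqr_ge0.
Qed.

Lemma norm2_ge0 (R : realType) (St Ac : finType) (g : St -> Ac -> R) : 0 <= norm2 g.
Proof. exact: sqrtr_ge0. Qed.

Lemma norm2_ub (R : realType) (St Ac : finType) (g : St -> Ac -> R) s a :
  `|g s a| <= norm2 g.
Proof.
rewrite -(@ler_pXn2r _ 2) ?nnegrE ?norm2_ge0 ?normr_ge0 // norm2_sq.
rewrite real_normK ?num_real // (bigD1 s) //= (bigD1 a) //= -addrA lerDl.
apply: addr_ge0; first by apply: sumr_ge0 => i _; exact: sqr_ge0.
by apply: sumr_ge0 => s' _; apply: sumr_ge0 => a' _; exact: sqr_ge0.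
Qed.

Section Ascent.
Variables (R : realType) (St Ac : finType).
Variables (P : St -> Ac -> St -> R) (r : St -> Ac -> R) (gamma : R).
Hypothesis mdpP : is_mdp P r gamma.
Variable mu : St -> R.
Hypothesis mu_distr : is_distr mu.
Hypothesis mu_gt0 : forall s, 0 < mu s.
Implicit Types (theta x : St -> Ac -> R) (s : St) (a : Ac).
Variable act : St -> Ac.

Local Notation q := (1 - gamma).
Local Notation V := (Vnu P r gamma).
Local Notation d := (dvis P gamma).
Local Notation policy := (softmax_policy act).
Local Notation T := (Cinf P gamma mu mu - (1 - gamma)).
Local Notation grad := (grad P r gamma mu).

Let q0 : 0 < q := mdp_1gamma_gt0 mdpP.

Definition npg_dir eta theta s a := eta * (grad theta s a / norm2 (grad theta)).

Lemma npg_stepE eta theta :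
  npg_step P r gamma mu eta theta = fun s a => theta s a + npg_dir eta theta s a.
Proof. by []. Qed.

Lemma npg_dir_le eta theta s a : 0 <= eta -> `|npg_dir eta theta s a| <= eta.
Proof.
move=> e0; rewrite normrM ger0_norm // ler_piMr // normrM normfV.
rewrite (ger0_norm (norm2_ge0 _)).
(* At a zero gradient the convention [0^-1 = 0] makes the step zero. *)
have [->|n0] := eqVneq (norm2 (grad theta)) 0; first by rewrite invr0 mulr0.
by rewrite ler_pdivrMr ?mul1r ?norm2_ub // lt_def n0 norm2_ge0.
Qed.

(** Factor shared by all actions at [s]: the policy gradient formula makes each increment this
    factor times probability times advantage. *)
Definition npg_rate eta theta s := eta * (d (softmax theta) mu s / q / norm2 (grad theta)).

Lemma npg_rate_ge0 eta theta s : 0 <= eta -> 0 <= npg_rate eta theta s.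
Proof.
move=> e0; rewrite mulr_ge0 // divr_ge0 ?norm2_ge0 // divr_ge0 ?(ltW q0) //.
exact/(dvis_ge0 mdpP)/mu_distr/policy.
Qed.

Lemma npg_dirE eta theta s a : npg_dir eta theta s a =
  npg_rate eta theta s * (softmax theta s a * adv P r gamma (softmax theta) s a).
Proof.
by rewrite /npg_dir (policy_gradient mdpP mu_distr mu_gt0 act) /npg_rate; ring.
Qed.

Lemma npg_dir_aligned eta theta s a : 0 <= eta ->
  0 <= softmax theta s a * adv P r gamma (softmax theta) s a * npg_dir eta theta s a.
Proof.
by move=> e0; rewrite npg_dirE mulrCA mulr_ge0 ?npg_rate_ge0 // -expr2 sqr_ge0.
Qed.

Lemma npg_gain eta theta s : 0 <= eta ->
  (\sum_a softmax theta s a * adv P r gamma (softmax theta) s a * npg_dir eta theta s a)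
    / (1 + eta) <=
  \sum_a softmax theta s a * adv P r gamma (softmax theta) s a
    * (expR (npg_dir eta theta s a) - 1).
Proof.
move=> e0; rewrite mulr_suml; apply: ler_sum => a _; apply: tilt_gain.
  exact: npg_dir_aligned.
exact: npg_dir_le.
Qed.

(** Performance difference from a Dirac mass: increments have the sign of the advantages, so every
    term is nonnegative. *)
Lemma npg_monotone eta theta s : 0 <= eta ->
  Vfun P r gamma (softmax theta) s <=
  Vfun P r gamma (softmax (npg_step P r gamma mu eta theta)) s.
Proof.
move=> e0; rewrite -!(Vnu_dirac P r gamma) -subr_ge0 -(pmulr_rge0 _ q0) npg_stepE.
rewrite (Vnu_softmaxD mdpP act); last exact: dirac_distr.
apply: sumr_ge0 => s' _; apply: mulr_ge0.
  by apply: (dvis_ge0 mdpP); [exact: policy|exact: dirac_distr].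
apply: divr_ge0; last exact/ltW/(tilt_norm_gt0 _ _ _ (act s')).
apply: le_trans (npg_gain theta s' e0); apply: divr_ge0; last by rewrite addr_ge0.
by apply: sumr_ge0 => a _; exact: npg_dir_aligned.
Qed.

Lemma concentrability_excess_ge0 (s : St) : 0 <= T.
Proof.
rewrite subr_ge0; apply: (Cinf_ge mdpP mu_distr mu_gt0 s (policy (fun _ _ => 0))).
Qed.

Lemma npg_eta_le eta (s : St) : 0 <= eta -> eta * (6 * q + 8 * T) <= q -> eta <= 6^-1.
Proof.
move=> e0; have := mulr_ge0 e0 (concentrability_excess_ge0 s); have := q0.
set t := T; set u := 1 - gamma; nra.
Qed.

(** The factor is chosen for [npg_ascent], where [1 / (1 + eta)] is lost by linearizing the
    exponential and [1 - eta] by the normalizer: against it, half of the old visitation remains. *)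
Lemma npg_visitation eta theta s : 0 <= eta -> eta * (6 * q + 8 * T) <= q ->
  d (softmax theta) mu s <= (1 - eta) / (1 + eta) * 2 *
    d (softmax (npg_step P r gamma mu eta theta)) mu s.
Proof.
move=> e0 eq; set d1 := d (softmax (npg_step _ _ _ _ _ _)) mu s.
have d10 : 0 <= d1 by apply: (dvis_ge0 mdpP) => //; exact: policy.
have T0 := concentrability_excess_ge0 s.
have e6 := npg_eta_le s e0 eq.
have e2 : 0 < 1 - eta *+ 2 by lra.
set eps := expR (eta *+ 2) - 1.
have epsE : eps * (1 - eta *+ 2) <= eta *+ 2.
  have h := expR_ge1Dx (- (eta *+ 2)); rewrite expRN in h.
  have ee : 0 < expR (eta *+ 2) := expR_gt0 _.
  have : expR (eta *+ 2) * (1 - eta *+ 2) <= 1.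
    by rewrite -[leRHS](mulVf (lt0r_neq0 ee)) [leLHS]mulrC ler_wpM2r // ltW.
  by rewrite /eps; lra.
have eps0 : 0 <= eps by rewrite subr_ge0 expR_ge1 ?mulrn_wge0.
have := dvis_compare mdpP mu_distr mu_gt0 s (policy theta)
  (policy (npg_step P r gamma mu eta theta))
  (softmaxD_close theta (fun s a => npg_dir_le theta s a e0)).
rewrite -/eps -/d1 => H.
have {}H : q * d (softmax theta) mu s <= (q + eps * T) * d1.
  move: H; rewrite -[X in X * `|_|]gtr0_norm // -normrM ler_norml => /andP[H _].
  by move: H; rewrite mulrBr mulrDl; lra.
rewrite -(ler_pM2l q0); apply: (le_trans H).
rewrite [leRHS]mulrA ler_wpM2r //.
have -> : q * ((1 - eta) / (1 + eta) * 2) = q * (2 * (1 - eta)) / (1 + eta) by ring.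
have e1 : 0 < 1 + eta by lra.
rewrite ler_pdivlMr //.
(* [epsE] bounds the left side by [8 * eta * T], and the step size condition bounds that by the
   right side. *)
have epsT : eps * T * (4 * (1 - eta *+ 2)) <= q * (1 - 6 * eta).
  have : eps * (1 - eta *+ 2) * T <= eta *+ 2 * T by rewrite ler_wpM2r.
  by move: eq; rewrite mulr2n; set t := T; set u := 1 - gamma; lra.
have e24 : 0 < 4 * (1 - eta *+ 2) by lra.
rewrite -(ler_pM2r e24).
(* Divided by [q] this reads [0 <= 30 * eta^2 - 15 * eta + 3], a multiple of the square below plus a
   positive constant. *)
have : (q * (4 * (1 - eta *+ 2)) + q * (1 - 6 * eta)) * (1 + eta) <=
  q * (2 * (1 - eta)) * (4 * (1 - eta *+ 2)).
  rewrite -mulrDr -!mulrA ler_wpM2l ?(ltW q0) // mulr2n.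
  by have := sqr_ge0 (2 * eta - 1 / 2); nra.
apply: le_trans; rewrite mulrAC ler_wpM2r ?(ltW e1) //.
by rewrite mulrDl lerD2l.
Qed.

(* The gain comes from the performance difference identity alone: no smoothness of the
   value function is used. *)
Lemma npg_ascent eta theta : 0 <= eta -> eta * (6 * q + 8 * T) <= q ->
  eta / 2 * norm2 (grad theta) <=
  V (softmax (npg_step P r gamma mu eta theta)) mu - V (softmax theta) mu.
Proof.
move=> e0 eq; rewrite -(ler_pM2l q0) npg_stepE (Vnu_softmaxD mdpP act) // -npg_stepE.
pose x := npg_dir eta theta.
pose B s := \sum_a softmax theta s a * adv P r gamma (softmax theta) s a * x s a.
have B0 s : 0 <= B s by apply: sumr_ge0 => a _; exact: npg_dir_aligned.
(* The target is half of the first-order gain: the normalized step has inner product [eta * norm2]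
   with the gradient. *)
have linear : q * (eta / 2 * norm2 (grad theta)) = \sum_s d (softmax theta) mu s / 2 * B s.
  have -> : norm2 (grad theta) = norm2 (grad theta) ^+ 2 / norm2 (grad theta).
    have [->|n0] := eqVneq (norm2 (grad theta)) 0; first by rewrite invr0 mulr0.
    by rewrite expr2 mulfK.
  rewrite norm2_sq !mulr_suml !mulr_sumr; apply: eq_bigr => s _.
  rewrite !mulr_suml !mulr_sumr; apply: eq_bigr => a _.
  rewrite /x /npg_dir; set n := norm2 _.
  rewrite (policy_gradient mdpP mu_distr mu_gt0 act); set m := n^-1; field.
  exact: lt0r_neq0.
rewrite linear; apply: ler_sum => s _.
have e6 := npg_eta_le s e0 eq.
set Z := tilt_norm _ _ s; have Z0 : 0 < Z by exact: (tilt_norm_gt0 _ _ _ (act s)).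
have Zi : 1 - eta <= Z^-1.
  have /andP[_ Zu] := tilt_norm_bounds theta act (fun a => npg_dir_le theta s a e0).
  apply: (@le_trans _ _ (expR eta)^-1); last by rewrite lef_pV2 ?posrE ?expR_gt0.
  by rewrite -expRN; exact: expR_ge1Dx.
have gain : B s * (1 - eta) / (1 + eta) <=
   (\sum_a softmax theta s a * adv P r gamma (softmax theta) s a * (expR (x s a) - 1)) / Z.
  rewrite mulrAC; apply: ler_pM => //; last exact: npg_gain.
  - by apply: divr_ge0 => //; rewrite addr_ge0.
  - by rewrite subr_ge0; lra.
set d1 := d (softmax (npg_step _ _ _ _ _ _)) mu s.
have d10 : 0 <= d1 by apply: (dvis_ge0 mdpP) => //; exact: policy.
apply: le_trans (ler_wpM2l d10 gain).
have -> : d1 * (B s * (1 - eta) / (1 + eta)) =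
   ((1 - eta) / (1 + eta) * 2 * d1) / 2 * B s.
  by field; rewrite lt0r_neq0 // ltr_pwDl.
by rewrite ler_wpM2r // ler_wpM2r ?npg_visitation // invr_ge0.
Qed.

End Ascent.

(** * Gradient domination and regret *)

(** Cauchy-Schwarz against the constant 1: the sum of [(x i - x j) ^+ 2] over all pairs is twice the
    difference of the two sides. *)
Lemma sum_sqr_le (R : realFieldType) (I : finType) (x : I -> R) :
  (\sum_i x i) ^+ 2 <= #|I|%:R * \sum_i x i ^+ 2.
Proof.
have : 0 <= \sum_i \sum_j (x i - x j) ^+ 2.
  by apply: sumr_ge0 => i _; apply: sumr_ge0 => j _; exact: sqr_ge0.
have -> : \sum_i \sum_j (x i - x j) ^+ 2 =
    (#|I|%:R * \sum_i x i ^+ 2 - (\sum_i x i) ^+ 2) *+ 2.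
  have -> : \sum_i \sum_j (x i - x j) ^+ 2 =
      \sum_i \sum_(j : I) x i ^+ 2 + \sum_(i : I) \sum_j x j ^+ 2 - (\sum_i \sum_j x i * x j) *+ 2.
    rewrite -sumrMnl -big_split -sumrB /=; apply: eq_bigr => i _.
    rewrite -sumrMnl -big_split -sumrB /=; apply: eq_bigr => j _; ring.
  have -> : \sum_i \sum_(j : I) x i ^+ 2 = #|I|%:R * \sum_i x i ^+ 2.
    rewrite mulr_sumr; apply: eq_bigr => i _.
    by rewrite sumr_const mulr_natl.
  have -> : \sum_(i : I) \sum_j x j ^+ 2 = #|I|%:R * \sum_i x i ^+ 2.
    by rewrite sumr_const mulr_natl.
  have -> : \sum_i \sum_j x i * x j = (\sum_i x i) ^+ 2.
    by rewrite expr2 mulr_suml; apply: eq_bigr => i _; rewrite mulr_sumr.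
  ring.
by rewrite pmulrn_lge0 // subr_ge0.
Qed.

Section Gap.
Variables (R : realType) (St Ac : finType).
Variables (P : St -> Ac -> St -> R) (r : St -> Ac -> R) (gamma : R).
Hypothesis mdpP : is_mdp P r gamma.
Variable mu : St -> R.
Hypothesis mu_distr : is_distr mu.
Hypothesis mu_gt0 : forall s, 0 < mu s.
Implicit Types (theta x : St -> Ac -> R) (s : St) (a : Ac) (nu : St -> R).
Variable astar : St -> Ac.

Local Notation q := (1 - gamma).
Local Notation V := (Vnu P r gamma).
Local Notation d := (dvis P gamma).
Local Notation policy := (softmax_policy astar).
Local Notation grad := (grad P r gamma mu).
Local Notation pistar := (det_policy R astar).

Let q0 : 0 < q := mdp_1gamma_gt0 mdpP.

Lemma det_policyP : is_policy pistar.
Proof.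
split=> [s a|s]; first by rewrite /det_policy; case: ifP.
by have := sum_pred1 (astar s) (fun=> 1 : R); under eq_bigr do rewrite mulr1.
Qed.

Lemma sum_det_policy s (F : Ac -> R) : \sum_a pistar s a * F a = F (astar s).
Proof. exact: sum_pred1. Qed.

Lemma ratio_det_ge (s : St) : q <= ratio_inf (d pistar mu) mu.
Proof.
rewrite -(ler_pM2r (mu_gt0 s)); apply: le_trans (ratio_inf_ub _ (mu_gt0 s)).
exact/(dvis_ge mdpP)/mu_distr/det_policyP.
Qed.

Lemma sum_grad_le theta :
  \sum_s `|grad theta s (astar s)| <= Num.sqrt #|St|%:R * norm2 (grad theta).
Proof.
rewrite -(@ler_pXn2r _ 2) ?nnegrE ?mulr_ge0 ?sqrtr_ge0 ?norm2_ge0 ?sumr_ge0 //.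
apply: (le_trans (sum_sqr_le _)); rewrite exprMn sqr_sqrtr ?ler0n // norm2_sq.
rewrite ler_wpM2l ?ler0n //; apply: ler_sum => s _.
rewrite real_normK ?num_real // (bigD1 (astar s)) //= lerDl.
by apply: sumr_ge0 => a _; exact: sqr_ge0.
Qed.

(** In the performance difference towards [pistar] only the advantages of [astar s] occur. Passing
    from the visitation of [pistar] to [mu] costs [D], from [mu] to the current visitation [1 / q],
    and inserting the probability of [astar s] costs [1 / c]. This leaves gradient entries, one per
    state, whose sum costs the square root of the number of states. *)
Lemma gradient_domination theta c : (forall s, c <= softmax theta s (astar s)) -> 0 <= c ->
  c * q * (V pistar mu - V (softmax theta) mu) <=
  Num.sqrt #|St|%:R * ratio_inf (d pistar mu) mu * norm2 (grad theta).
Proof.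
move=> cpi c0; set D := ratio_inf _ _.
have D0 : 0 <= D by exact: ratio_inf_ge0.
apply: (@le_trans _ _ (D * \sum_s `|grad theta s (astar s)|)); last first.
  by rewrite [_ * D]mulrC -mulrA ler_wpM2l // sum_grad_le.
rewrite -mulrA (Vnu_diff mdpP (policy theta) det_policyP mu_distr).
rewrite !mulr_sumr; apply: ler_sum => s _; rewrite sum_det_policy.
rewrite (policy_gradient mdpP mu_distr mu_gt0 astar).
set A := adv _ _ _ _ _ _; set p := softmax _ _ _.
have p0 : 0 < p by exact: softmax_gt0.
have cp : c <= p := cpi s.
have dq : q * mu s <= d (softmax theta) mu s by exact/(dvis_ge mdpP)/mu_distr/policy.
have dD : d pistar mu s <= D * mu s by exact: ratio_inf_ub.
have dst0 : 0 <= d pistar mu s by exact/(dvis_ge0 mdpP)/mu_distr/det_policyP.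
move: (d pistar mu s) (d (softmax theta) mu s) dq dD dst0 => y z dq dD dst0.
clearbody A p.
rewrite [`|_ / q|]normrM [`|_ * A|]normrM [`|_ * p|]normrM normfV.
rewrite (gtr0_norm q0) (gtr0_norm p0).
rewrite (@ger0_norm _ z); last by apply: le_trans dq; rewrite ltW ?mulr_gt0.
rewrite !mulrA ler_pdivlMr //.
apply: (@le_trans _ _ (p * (D * mu s) * `|A| * q)).
  rewrite ler_wpM2r ?(ltW q0) //.
  apply: (@le_trans _ _ (c * y * `|A|)).
    by rewrite ler_wpM2l ?mulr_ge0 // ler_norm.
  by rewrite ler_wpM2r // ler_pM.
have -> : p * (D * mu s) * `|A| * q = D * (q * mu s) * p * `|A| by ring.
by rewrite ler_wpM2r // ler_wpM2r ?(ltW p0) // ler_wpM2l.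
Qed.

Hypothesis astar_best : forall s a, a != astar s ->
  Qfun P r gamma pistar s a < Qfun P r gamma pistar s (astar s).

Lemma Vstar_Q s : Vfun P r gamma pistar s = Qfun P r gamma pistar s (astar s).
Proof. by rewrite (Vfun_bellman mdpP) ?sum_det_policy //; exact: det_policyP. Qed.

Lemma advstar_le0 s a : adv P r gamma pistar s a <= 0.
Proof.
rewrite /adv Vstar_Q subr_le0.
by have [->//|/astar_best/ltW] := eqVneq a (astar s).
Qed.

Lemma advstar_lt0 s a : a != astar s -> adv P r gamma pistar s a < 0.
Proof. by rewrite /adv Vstar_Q subr_lt0; exact: astar_best. Qed.

(** One-step loss of [pi] measured by the advantages of [pistar]: nonnegative, and it makes value
    gaps sums of nonnegative terms. *)
Definition regret pi s := - \sum_a pi s a * adv P r gamma pistar s a.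

Lemma regret_ge0 pi s : is_policy pi -> 0 <= regret pi s.
Proof.
case=> p0 _; rewrite oppr_ge0; apply: sumr_le0 => a _.
by rewrite mulr_ge0_le0 // advstar_le0.
Qed.

Lemma Vstar_diff pi nu : is_policy pi -> is_distr nu ->
  q * (V pistar nu - V pi nu) = \sum_s d pi nu s * regret pi s.
Proof.
move=> hpi hnu; rewrite -[X in q * X]opprB mulrN (Vnu_diff mdpP det_policyP hpi hnu) -sumrN.
by apply: eq_bigr => s _; rewrite /regret mulrN.
Qed.

Lemma Vstar_ge pi nu : is_policy pi -> is_distr nu -> V pi nu <= V pistar nu.
Proof.
move=> hpi hnu; rewrite -subr_ge0 -(pmulr_rge0 _ q0) Vstar_diff //.
by apply: sumr_ge0 => s _; rewrite mulr_ge0 ?(dvis_ge0 mdpP) ?regret_ge0.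
Qed.

(** Both gaps sum the same regrets, with weights [d pi rho <= Cinf * mu] and [d pi mu >= q * mu]. *)
Lemma Vstar_transfer pi rho : is_policy pi -> is_distr rho ->
  q * (V pistar rho - V pi rho) <= Cinf P gamma rho mu * (V pistar mu - V pi mu).
Proof.
move=> hpi hrho; rewrite -(ler_pM2l q0) Vstar_diff // [leRHS]mulrCA Vstar_diff //.
rewrite !mulr_sumr; apply: ler_sum => s _.
have R0 := regret_ge0 s hpi.
have dC := dvis_le_Cinf mdpP mu_gt0 s hpi hrho.
have d0 : 0 <= d pi rho s by exact: (dvis_ge0 mdpP).
have dm := dvis_ge mdpP s hpi mu_distr.
move: (d pi rho s) (d pi mu s) (Cinf P gamma rho mu) dC d0 dm => x y C dC d0 dm.
have C0 : 0 <= C by rewrite -(pmulr_lge0 _ (mu_gt0 s)); exact: le_trans dC.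
rewrite !mulrA ler_wpM2r //; apply: (@le_trans _ _ (q * (C * mu s))).
  by rewrite ler_wpM2l // ltW.
by rewrite mulrCA ler_wpM2l.
Qed.

(** Started at [s], the process gives [s] itself visitation at least [q]; the other terms of the gap
    are nonnegative. *)
Lemma regret_le_gap pi s : is_policy pi ->
  regret pi s <= Vfun P r gamma pistar s - Vfun P r gamma pi s.
Proof.
move=> hpi; have hs := dirac_distr R s.
rewrite -(ler_pM2l q0) -!(Vnu_dirac P r gamma) Vstar_diff // (bigD1 s) //=.
rewrite ler_wpDr //.
  by apply: sumr_ge0 => s' _; rewrite mulr_ge0 ?(dvis_ge0 mdpP) ?regret_ge0.
rewrite ler_wpM2r ?regret_ge0 //; apply: le_trans (dvis_ge mdpP s hpi hs).
by rewrite /dirac_st eqxx mulr1.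
Qed.

End Gap.

(** * Global convergence *)

Lemma positive_lower_bound (R : realDomainType) (I : finType) (Q : pred I) (f : I -> R) :
  (forall i, Q i -> 0 < f i) -> exists2 e : R, 0 < e & forall i, Q i -> e <= f i.
Proof.
move=> f0; exists (\big[Num.min/1]_(i | Q i) f i); first exact: lt_bigmin.
by move=> i Qi; exact: bigmin_le_cond.
Qed.

Lemma expRN_le_negative (R : realType) (x y : R) :
  `|x| <= 2^-1 -> - x <= y -> 0 <= y -> expR (- x) - 1 <= 2 * y.
Proof.
move=> xh xy y0; have [x0|x0] := leP 0 x.
  apply: (@le_trans _ _ 0); last by lra.
  by rewrite subr_le0 -[leRHS]expR0 ler_expR oppr_le0.
have xh' : - x <= 2^-1 by move: xh; rewrite ltr0_norm.
have e0 := expR_gt0 x; have ex := expR_ge1Dx x.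
apply: (@le_trans _ _ (2 * (- x))); last by lra.
rewrite lerBlDr expRN -(ler_pM2r e0) mulVf ?lt0r_neq0 //.
by nra.
Qed.

Lemma expRN_le_positive (R : realType) (x y : R) :
  `|x| <= 2^-1 -> 0 <= y <= x -> expR (- x) - 1 <= - (y / 2).
Proof.
move=> xh /andP[y0 yx]; have xh' : x <= 2^-1 by apply: le_trans xh; exact: ler_norm.
have e0 := expR_gt0 x; have ex := expR_ge1Dx x.
rewrite lerBlDr expRN -(ler_pM2r e0) mulVf ?lt0r_neq0 //.
by nra.
Qed.

Section Convergence.
Variables (R : realType) (St Ac : finType).
Variables (P : St -> Ac -> St -> R) (r : St -> Ac -> R) (gamma : R).
Hypothesis mdpP : is_mdp P r gamma.
Variable mu : St -> R.
Hypothesis mu_distr : is_distr mu.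
Hypothesis mu_gt0 : forall s, 0 < mu s.
Implicit Types (s : St) (a : Ac).
Variable astar : St -> Ac.

Local Notation q := (1 - gamma).
Local Notation V := (Vnu P r gamma).
Local Notation d := (dvis P gamma).
Local Notation policy := (softmax_policy astar).
Local Notation grad := (grad P r gamma mu).
Local Notation T := (Cinf P gamma mu mu - (1 - gamma)).

Let q0 : 0 < q := mdp_1gamma_gt0 mdpP.

Variables (eta : R) (th : nat -> St -> Ac -> R).
Hypothesis eta_gt0 : 0 < eta.
Hypothesis eta_small : eta * (6 * q + 8 * T) <= q.
Hypothesis thS : forall t, th t.+1 = npg_step P r gamma mu eta (th t).

Local Notation pi t := (softmax (th t)).
Local Notation A t := (adv P r gamma (softmax (th t))).

Let thE t s a : th t.+1 s a = th t s a + npg_dir P r gamma mu eta (th t) s a.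
Proof. by rewrite thS npg_stepE. Qed.

(** Increments at [s] are proportional to probability times advantage, which sums to zero. This
    turns lower bounds on the logits into upper bounds. *)
Lemma npg_sum_const t s : \sum_a th t s a = \sum_a th 0%N s a.
Proof.
elim: t => // t <-; under eq_bigr do rewrite thE.
rewrite big_split /= [X in _ + X](_ : _ = 0) ?addr0 //.
under eq_bigr do rewrite (npg_dirE mdpP mu_distr mu_gt0 astar).
by rewrite -mulr_sumr (adv_mean0 mdpP) ?mulr0 //; exact: policy.
Qed.

Lemma Vnu_le (p : St -> Ac -> R) : is_policy p -> V p mu <= q^-1.
Proof.
move=> hp; have -> : q^-1 = \sum_s mu s * q^-1.
  by rewrite -mulr_suml (proj2 mu_distr) mul1r.
by apply: ler_sum => s _; rewrite ler_wpM2l ?(ltW (mu_gt0 s)) ?(Vfun_le mdpP).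
Qed.

Lemma Vnu_ge0 (p : St -> Ac -> R) : is_policy p -> 0 <= V p mu.
Proof.
move=> hp; apply: sumr_ge0 => s _.
by rewrite mulr_ge0 ?(ltW (mu_gt0 s)) ?(Vfun_ge0 mdpP).
Qed.

(** Each step would gain at least [eta / 2 * e], while values stay below [1 / q]. *)
Lemma grad_not_bounded_below N e : 0 < e ->
  (forall t, (N <= t)%N -> e <= norm2 (grad (th t))) -> False.
Proof.
move=> e0 ge.
have grow (k : nat) : k%:R * (eta / 2 * e) <= V (pi (N + k)%N) mu.
  elim: k => [|k IH]; first by rewrite mul0r Vnu_ge0 //; exact: policy.
  have := npg_ascent mdpP mu_distr mu_gt0 astar (th (N + k)%N) (ltW eta_gt0) eta_small.
  rewrite -thS addnS -[k.+1%:R]natr1 mulrDl mul1r => asc.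
  have : eta / 2 * e <= eta / 2 * norm2 (grad (th (N + k)%N)).
    by rewrite ler_wpM2l ?ge ?leq_addr // divr_ge0 ?ltW.
  by move: IH asc; lra.
have c0 : 0 < eta / 2 * e by rewrite mulr_gt0 // divr_gt0.
have [k hk] : exists k : nat, q^-1 / (eta / 2 * e) < k%:R.
  by exists (Num.bound (q^-1 / (eta / 2 * e))); rewrite archi_boundP // divr_ge0 ?invr_ge0 ?ltW.
have := le_trans (grow k) (Vnu_le (policy _)).
by rewrite leNgt -ltr_pdivrMr // hk.
Qed.

(* Since [expR (- th) * pi = 1 / Z], the increments of [expR (- th t s a)] do not see the
   small probabilities: the gain of the action [b] pays for the loss of any other one. *)
Lemma logits_bounded_below s b N Delta : 0 < Delta ->
  (forall t, (N <= t)%N -> Delta <= A t s b) ->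
  (* [M] is the ratio of the largest loss [2 * k / (q * Z)] to the least gain [k * Delta / (2 * Z)]
     of action [b]; it makes [F] nonincreasing. *)
  exists2 B : R, 1 <= B & forall t a, (N <= t)%N -> expR (- th t s a) <= B.
Proof.
move=> D0 AD; pose M := 4 / (q * Delta).
have M0 : 0 < M by rewrite divr_gt0 ?mulr_gt0.
pose F t a := expR (- th t s a) + M * expR (- th t s b).
have F0 t a : 0 <= F t a by rewrite addr_ge0 ?expR_ge0 // mulr_ge0 ?expR_ge0 // ltW.
have Fdecr t a : (N <= t)%N -> F t.+1 a <= F t a.
  move=> Nt; pose k := npg_rate P r gamma mu eta (th t) s.
  have k0 : 0 <= k by apply: (npg_rate_ge0 mdpP mu_distr astar); exact: ltW.
  pose x a := npg_dir P r gamma mu eta (th t) s a.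
  have xE a1 : x a1 = k * (pi t s a1 * A t s a1).
    exact: (npg_dirE mdpP mu_distr mu_gt0 astar).
  have xh a1 : `|x a1| <= 2^-1.
    apply: (le_trans (npg_dir_le _ _ _ _ _ _ _ (ltW eta_gt0))).
    have := npg_eta_le mdpP mu_distr mu_gt0 astar s (ltW eta_gt0) eta_small.
    by lra.
  pose Z := \sum_a' expR (th t s a').
  have Z0 : 0 < Z by exact: (sum_expR_gt0 _ _ b).
  have EpZ a1 : expR (- th t s a1) * pi t s a1 = Z^-1.
    by rewrite /softmax mulrA -expRD addNr expR0 mul1r.
  have p0 a1 : 0 < pi t s a1 by exact: softmax_gt0.
  have lossa : expR (- th t.+1 s a) - expR (- th t s a) <= 2 * (k / (q * Z)).
    rewrite thE opprD expRD -/(x a) -[X in _ - X]mulr1 -mulrBr.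
    have -> : 2 * (k / (q * Z)) = expR (- th t s a) * (2 * (k * (pi t s a / q))).
      have -> : expR (- th t s a) * (2 * (k * (pi t s a / q))) =
        2 * (k / q) * (expR (- th t s a) * pi t s a) by ring.
      by rewrite EpZ; field; rewrite !lt0r_neq0.
    rewrite ler_wpM2l ?expR_ge0 //; apply: expRN_le_negative => //.
      rewrite xE -mulrN ler_wpM2l // -mulrN ler_wpM2l ?(ltW (p0 _)) //.
      by rewrite lerNl; exact: (adv_ge mdpP _ _ (policy _)).
    by rewrite mulr_ge0 // divr_ge0 // ltW.
  have gainb : expR (- th t.+1 s b) - expR (- th t s b) <= - (k * Delta / (2 * Z)).
    rewrite thE opprD expRD -/(x b) -[X in _ - X]mulr1 -mulrBr.
    have -> : - (k * Delta / (2 * Z)) =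
        expR (- th t s b) * - (k * (pi t s b * Delta) / 2).
      have -> : expR (- th t s b) * - (k * (pi t s b * Delta) / 2) =
        - (k * Delta / 2) * (expR (- th t s b) * pi t s b) by ring.
      by rewrite EpZ; field; rewrite lt0r_neq0.
    rewrite ler_wpM2l ?expR_ge0 //; apply: expRN_le_positive => //.
    have pD0 : 0 <= k * (pi t s b * Delta).
      by apply: mulr_ge0 => //; apply: mulr_ge0; exact: ltW.
    by rewrite pD0 xE ler_wpM2l // ler_wpM2l ?(ltW (p0 b)) ?AD.
  have := ler_wpM2l (ltW M0) gainb.
  have -> : M * - (k * Delta / (2 * Z)) = - (2 * (k / (q * Z))).
    by rewrite /M; field; rewrite !lt0r_neq0.
  by rewrite /F mulrBr; move: lossa; lra.
have Fle t a : (N <= t)%N -> F t a <= F N a.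
  move/subnK => <-; elim: (t - N)%N => // i IH.
  by apply: le_trans IH; rewrite addSn Fdecr // leq_addl.
(* The added 1 makes [ln B] nonnegative later. *)
exists (1 + \sum_a F N a); first by rewrite lerDl sumr_ge0.
move=> t a Nt; apply: (@le_trans _ _ (F t a)).
  by rewrite lerDl mulr_ge0 ?expR_ge0 // ltW.
apply: (le_trans (Fle t a Nt)); rewrite (bigD1 a) //= addrCA lerDl.
by rewrite addr_ge0 // sumr_ge0.
Qed.

(** Logits at [s] bounded on both sides keep the probability of [b] above some [p > 0], so the
    gradient entry at [(s, b)] stays above [mu s * p * Delta]. *)
Lemma no_persistent_advantage s b N Delta : 0 < Delta ->
  (forall t, (N <= t)%N -> Delta <= A t s b) -> False.
Proof.
move=> D0 AD; have [B B1 EB] := logits_bounded_below D0 AD.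
have B0 : 0 < B by apply: lt_le_trans B1.
have L0 : 0 <= ln B by exact: ln_ge0.
have thL t a : (N <= t)%N -> - ln B <= th t s a.
  by move=> Nt; rewrite lerNl -ler_expR lnK ?posrE // EB.
pose U := \sum_a th 0%N s a + ln B * #|Ac|%:R.
have thU t a : (N <= t)%N -> th t s a <= U.
  move=> Nt; have -> : U = \sum_a (th t s a + ln B).
    by rewrite /U big_split /= (npg_sum_const t) sumr_const mulr_natr.
  rewrite (bigD1 a) //= -addrA lerDl addr_ge0 // sumr_ge0 // => a' _.
  by rewrite -lerBlDr sub0r thL.
pose p := expR (- ln B) / (#|Ac|%:R * expR U).
have c0 : 0 < #|Ac|%:R :> R by rewrite ltr0n; apply/card_gt0P; exists b.
have p0 : 0 < p by rewrite divr_gt0 ?mulr_gt0 ?expR_gt0.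
have pip t : (N <= t)%N -> p <= pi t s b.
  move=> Nt; apply: ler_pM; rewrite ?expR_ge0 ?invr_ge0 ?mulr_ge0 ?expR_ge0 ?(ltW c0) //.
    by rewrite ler_expR thL.
  rewrite lef_pV2 ?posrE ?mulr_gt0 ?expR_gt0 ?(sum_expR_gt0 _ _ b) //.
  have -> : #|Ac|%:R * expR U = \sum_(a : Ac) expR U by rewrite sumr_const mulr_natl.
  apply: ler_sum => a _.
  by rewrite ler_expR thU.
clearbody p; apply: (@grad_not_bounded_below N (mu s * p * Delta)); first by rewrite !mulr_gt0.
move=> t Nt; apply: le_trans (norm2_ub _ s b).
rewrite (policy_gradient mdpP mu_distr mu_gt0 astar); apply: le_trans (ler_norm _).
rewrite ler_pdivlMr //.
have -> : mu s * p * Delta * q = (q * mu s) * p * Delta by ring.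
apply: ler_pM; rewrite ?(ltW D0) ?AD // ?mulr_ge0 ?(ltW q0) ?(ltW p0) ?(ltW (mu_gt0 s)) //.
apply: ler_pM; rewrite ?pip ?(ltW p0) ?mulr_ge0 ?(ltW q0) ?(ltW (mu_gt0 s)) //.
exact/(dvis_ge mdpP)/mu_distr/policy.
Qed.

End Convergence.

(** * Optimality of the limit and positivity of the constant *)

Section GlobalConvergence.
Variables (R : realType) (St Ac : finType).
Variables (P : St -> Ac -> St -> R) (r : St -> Ac -> R) (gamma : R).
Hypothesis mdpP : is_mdp P r gamma.
Variable mu : St -> R.
Hypothesis mu_distr : is_distr mu.
Hypothesis mu_gt0 : forall s, 0 < mu s.
Implicit Types (s : St) (a : Ac).
Variable astar : St -> Ac.

Local Notation q := (1 - gamma).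
Local Notation V := (Vnu P r gamma).
Local Notation d := (dvis P gamma).
Local Notation policy := (softmax_policy astar).
Local Notation T := (Cinf P gamma mu mu - (1 - gamma)).
Local Notation pistar := (det_policy R astar).

Let q0 : 0 < q := mdp_1gamma_gt0 mdpP.

Variables (eta : R) (th : nat -> St -> Ac -> R).
Hypothesis eta_gt0 : 0 < eta.
Hypothesis eta_small : eta * (6 * q + 8 * T) <= q.
Hypothesis thS : forall t, th t.+1 = npg_step P r gamma mu eta (th t).

Local Notation v t := (Vfun P r gamma (softmax (th t))).

Definition Vlim s := limn (fun t => v t s).

Let v_nondecreasing s : nondecreasing_seq (fun t => v t s).
Proof.
apply/nondecreasing_seqP => t; rewrite thS.
by apply: (npg_monotone mdpP mu_distr mu_gt0 astar); exact: ltW.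
Qed.

Let v_cvg s : cvgn (fun t => v t s).
Proof.
apply: nondecreasing_is_cvgn; first exact: v_nondecreasing.
by exists q^-1 => _ [t _ <-]; exact/(Vfun_le mdpP)/policy.
Qed.

Lemma Vlim_ge t s : v t s <= Vlim s.
Proof. exact: (nondecreasing_cvgn_le (v_nondecreasing s) (@v_cvg s)). Qed.

(** Otherwise the values of [(s, a)] eventually exceed the midpoint of [Vlim s] and [Qlim], while
    [v t s <= Vlim s]: the advantage stays above half the gap. *)
Lemma Vlim_optimality s a : r s a + gamma * \sum_s' P s a s' * Vlim s' <= Vlim s.
Proof.
rewrite leNgt; apply/negP; set Qlim := r s a + _ => gap.
have Qcvg : (Qfun P r gamma (softmax (th t)) s a @[t --> \oo] --> Qlim)%classic.
  apply: cvgD; first exact: cvg_cst.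
  by apply: cvgZl_tmp; apply: cvg_sumr => s'; apply: cvgZl_tmp; exact: v_cvg.
have mid : (Qlim + Vlim s) / 2 < Qlim by lra.
have [N _ HN] := cvgr_gt _ Qcvg _ mid.
apply: (@no_persistent_advantage _ _ _ P r gamma mdpP mu mu_distr mu_gt0 astar eta th
  eta_gt0 eta_small thS s a N ((Qlim - Vlim s) / 2)); first by lra.
move=> t Nt; have := HN t Nt; have := Vlim_ge t s; rewrite /adv /=.
by lra.
Qed.

(** The optimality inequality at [astar] makes [f - gamma * P f] nonnegative for [pistar], hence [f]
    itself by [dvis_resolvent]. *)
Lemma Vlim_ge_Vstar s : Vfun P r gamma pistar s <= Vlim s.
Proof.
have hs := dirac_distr R s; have hp := det_policyP R astar.
pose f s' := Vlim s' - Vfun P r gamma pistar s'.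
suff : 0 <= q * \sum_s' dirac_st R s s' * f s' by rewrite pmulr_rge0 // sum_pred1 subr_ge0.
rewrite (dvis_resolvent mdpP f hp hs); apply: sumr_ge0 => s' _.
rewrite mulr_ge0 ?(dvis_ge0 mdpP) //.
have -> : \sum_j Ppi P pistar s' j * f j =
    \sum_j P s' (astar s') j * Vlim j - \sum_j P s' (astar s') j * Vfun P r gamma pistar j.
  rewrite -sumrB; apply: eq_bigr => j _.
  by rewrite /Ppi (sum_det_policy astar s' (fun a => P s' a j)) mulrBr.
have := Vlim_optimality s' (astar s').
rewrite /f (Vstar_Q mdpP) /Qfun mulrBr; lra.
Qed.

Hypothesis astar_best : forall s a, a != astar s ->
  Qfun P r gamma pistar s a < Qfun P r gamma pistar s (astar s).

(** With [e] the least suboptimality gap, the regret is at least [e * (1 - pi(astar s|s))] and at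
    most the value gap. Once that gap is below [e / 2] the probability is at least 1/2; finitely
    many earlier iterates remain, each with positive probability. *)
Lemma softmax_astar_bounded_below :
  exists2 c : R, 0 < c & forall t s, c <= softmax (th t) s (astar s).
Proof.
have [e e0 gap] : exists2 e : R, 0 < e & forall sa : St * Ac, sa.2 != astar sa.1 ->
    e <= - adv P r gamma pistar sa.1 sa.2.
  apply: (positive_lower_bound (Q := fun sa => sa.2 != astar sa.1)) => -[s a] /= aa.
  by rewrite oppr_gt0; exact: (advstar_lt0 mdpP astar_best).
have regret_lb t s : e * (1 - softmax (th t) s (astar s)) <=
    regret P r gamma astar (softmax (th t)) s.
  have [p0 p1] := policy (th t).
  have -> : 1 - softmax (th t) s (astar s) = \sum_(a | a != astar s) softmax (th t) s a.
    apply/eqP; rewrite subr_eq addrC; apply/eqP.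
    by rewrite -[LHS](p1 s) (bigD1 (astar s)).
  rewrite /regret.
  have adv0 : adv P r gamma pistar s (astar s) = 0.
    by rewrite /adv -(Vstar_Q mdpP) subrr.
  rewrite [X in _ <= - X](bigD1 (astar s)) //= adv0 mulr0 add0r.
  rewrite mulr_sumr -sumrN; apply: ler_sum => a aa.
  by rewrite -mulrN mulrC ler_wpM2l // (gap (s, a)).
have late s : exists N, forall t, (N <= t)%N -> 2^-1 <= softmax (th t) s (astar s).
  have lt : Vfun P r gamma pistar s - e / 2 < Vlim s.
    by have := Vlim_ge_Vstar s; lra.
  have [N _ HN] := cvgr_gt _ (@v_cvg s) _ lt.
  exists N => t Nt; have := HN t Nt; rewrite /= => vt.
  have := le_trans (regret_lb t s) (regret_le_gap mdpP astar_best s (policy (th t))).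
  rewrite -(ler_pM2l e0) mulrBr mulr1; lra.
have all_times s : exists c : R, 0 < c /\ forall t, c <= softmax (th t) s (astar s).
  have [N HN] := late s.
  have [c c0 Hc] : exists2 c : R, 0 < c &
      forall i : 'I_N, true -> c <= softmax (th i) s (astar s).
    by apply: positive_lower_bound => i _; exact: softmax_gt0.
  exists (Num.min c 2^-1); split; first by rewrite lt_min c0 /= invr_gt0.
  move=> t; rewrite ge_min; have [tN|Nt] := ltnP t N.
    by rewrite (Hc (Ordinal tN)).
  by rewrite HN ?orbT.
have [c Hc] := choice all_times.
have [c' c'0 Hc'] : exists2 c' : R, 0 < c' & forall s, true -> c' <= c s.
  by apply: positive_lower_bound => s _; case: (Hc s).
exists c' => // t s; apply: le_trans (Hc' s isT) _.
by case: (Hc s).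
Qed.

End GlobalConvergence.

(** * Linear rate *)

Lemma geometric_decay (R : realType) (u : nat -> R) (C : R) :
  (forall t, 0 <= u t) -> (forall t, u t.+1 <= u t - C * u t) ->
  forall t, u t <= u 0%N * expR (- (C * t%:R)).
Proof.
move=> u0 uS; elim=> [|t IH]; first by rewrite mulr0 oppr0 expR0 mulr1.
have -> : - (C * t.+1%:R) = - (C * t%:R) - C by rewrite -natr1; ring.
rewrite expRD mulrA; apply: le_trans (uS t) _.
rewrite -[X in X - _]mulr1 [C * _]mulrC -mulrBr.
apply: (@le_trans _ _ (u t * expR (- C))); first by rewrite ler_wpM2l // expR_ge1Dx.
by rewrite ler_wpM2r // expR_ge0.
Qed.

Theorem theorem3 (R : realType) (St Ac : finType)
  (P : St -> Ac -> St -> R) (r : St -> Ac -> R) (gamma : R)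
  (mu rho : St -> R) (astar : St -> Ac) (theta : nat -> St -> Ac -> R) :
  is_mdp P r gamma ->
  is_distr mu -> (forall s, 0 < mu s) -> is_distr rho ->
  (* pi* choosing astar is optimal ... *)
  (forall pi, is_policy pi -> forall s,
      Vfun P r gamma pi s <= Vfun P r gamma (@det_policy R _ _ astar) s) ->
  (* ... and astar s is the unique optimal action at every state *)
  (forall s a, a != astar s ->
      Qfun P r gamma (@det_policy R _ _ astar) s a <
      Qfun P r gamma (@det_policy R _ _ astar) s (astar s)) ->
  let Cinf_mu := Cinf P gamma mu mu in
  let Cinf_rho := Cinf P gamma rho mu in
  let nS : R := #|St|%:R in
  let eta := (1 - gamma) / (6 * (1 - gamma) + 8 * (Cinf_mu - (1 - gamma)))
             / Num.sqrt nS in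
  (forall t, (1 <= t)%N ->
      theta t.+1 = npg_step P r gamma mu eta (theta t)) ->
  let c := inf [set x | exists s t, (1 <= t)%N /\
                        x = softmax (theta t) s (astar s)] in
  let Vstar := Vnu P r gamma (@det_policy R _ _ astar) in
  let C := (1 - gamma) ^+ 2 * c
           / (12 * (1 - gamma) + 16 * (Cinf_mu - (1 - gamma)))
           / nS / ratio_inf (dvis P gamma (@det_policy R _ _ astar) mu) mu in
  0 < c /\
  forall t, (1 <= t)%N ->
    Vstar rho - Vnu P r gamma (softmax (theta t)) rho <=
    (Vstar mu - Vnu P r gamma (softmax (theta 1%N)) mu) * Cinf_rho / (1 - gamma)
      * expR (- (C * (t%:R - 1))).
Proof.
move=> mdpP mu_distr mu_gt0 rho_distr _ astar_best T D nS eta thetaS c Vstar C.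
have q0 : 0 < 1 - gamma := mdp_1gamma_gt0 mdpP.
have hstar := det_policyP R astar.
have policy th : is_policy (@softmax R St Ac th) := softmax_policy astar th.
have [s0 _] : exists s0 : St, true.
  have [s0 _|none] := pickP (fun _ : St => true); first by exists s0.
  by have := proj2 mu_distr; rewrite big_pred0 // => /eqP; rewrite eq_sym oner_eq0.
have nS1 : 1 <= nS by rewrite ler1n; apply/card_gt0P; exists s0.
have T0 : 0 <= T - (1 - gamma) by exact: (concentrability_excess_ge0 mdpP mu_distr mu_gt0 astar s0).
set K := 6 * (1 - gamma) + 8 * (T - (1 - gamma)) in eta thetaS *.
have K0 : 0 < K by rewrite /K; lra.
have rS1 : 1 <= Num.sqrt nS by rewrite -[leLHS]sqrtr1 ler_wsqrtr.
have rS0 : 0 < Num.sqrt nS by exact: lt_le_trans rS1.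
have eta0 : 0 < eta by rewrite /eta !divr_gt0.
have eta_small : eta * K <= 1 - gamma.
  have -> : eta * K = (1 - gamma) / Num.sqrt nS by rewrite /eta; field; rewrite !lt0r_neq0.
  by rewrite ler_pdivrMr // ler_peMr // ltW.
(* Reindexing: the recursion holds from index 1 on, so [th 0] is [theta 1]. *)
pose th t := theta t.+1.
have thS t : th t.+1 = npg_step P r gamma mu eta (th t) by exact: thetaS.
have [p p0 pth] := softmax_astar_bounded_below mdpP mu_distr mu_gt0 eta0 eta_small thS astar_best.
have c_gt0 : 0 < c.
  apply: (lt_le_trans p0); apply: lb_le_inf.
    by exists (softmax (theta 1%N) s0 (astar s0)); exists s0, 1%N.
  by apply/lbP => _ [s [[|t] [t1 ->]]] //; exact: (pth t s).
split=> // -[//|t] _.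
have c_le t' s : c <= softmax (th t') s (astar s).
  rewrite /c; set E := [set x | _]%classic.
  have E0 : has_lbound E.
    by exists 0 => _ [s1 [t1 [_ ->]]]; exact/ltW/softmax_gt0.
  by have /lbP := ge_inf E0; apply; exists s, t'.+1.
pose u t := Vstar mu - Vnu P r gamma (softmax (th t)) mu.
have u0 t' : 0 <= u t' by rewrite subr_ge0; exact: (Vstar_ge mdpP astar_best).
have uS t' : u t'.+1 <= u t' - C * u t'.
  have asc := npg_ascent mdpP mu_distr mu_gt0 astar (th t') (ltW eta0) eta_small.
  have dom := gradient_domination mdpP mu_distr mu_gt0 (c_le t') (ltW c_gt0).
  rewrite -thS in asc; set n := norm2 _ in asc dom.
  set ratio := ratio_inf _ _ in dom; have ratio0 : 0 < ratio.
    exact: lt_le_trans q0 (ratio_det_ge mdpP mu_distr mu_gt0 astar s0).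
  (* One square root of the number of states comes from [eta], the other from gradient domination;
     together they give the factor [1 / nS] in [C]. *)
  have CE : C * u t' = eta / 2 * (c * (1 - gamma) * u t' / (Num.sqrt nS * ratio)).
    have -> : C = (1 - gamma) ^+ 2 * c / (2 * K) / Num.sqrt nS ^+ 2 / ratio.
      by rewrite sqr_sqrtr ?(le_trans _ nS1) // /C /K; congr (_ / _ / _ / _); ring.
    by rewrite /eta; field; rewrite !lt0r_neq0.
  have : C * u t' <= eta / 2 * n.
    rewrite CE; apply: ler_wpM2l; first by rewrite divr_ge0 ?(ltW eta0).
    clearbody ratio n; rewrite ler_pdivrMr; last by rewrite mulr_gt0.
    by rewrite [n * _]mulrC.
  by move: asc; rewrite /u; lra.
have decay := geometric_decay u0 uS t.
have -> : t.+1%:R - 1 = t%:R :> R by rewrite -natr1 addrK.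
have transfer := Vstar_transfer mdpP mu_distr mu_gt0 astar_best
  (policy (theta t.+1)) rho_distr.
have D0 : 0 <= D.
  rewrite -(pmulr_lge0 _ (mu_gt0 s0)).
  apply: le_trans (dvis_le_Cinf mdpP mu_gt0 s0 hstar rho_distr).
  exact: (dvis_ge0 mdpP).
rewrite mulrAC ler_pdivlMr // mulrC; apply: (le_trans transfer).
by rewrite [_ * D]mulrC -mulrA ler_wpM2l.
Qed.
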